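(* Let $K\in\mathbb R$, $N\in(1,\infty)$ and $D>0$, with $D\le\pi\sqrt{(N-1)/K}$ if $K>0$. For every $v\in(0,1)$, the one-dimensional isoperimetric profile function $\mathcal I_{K,N,D}$ has the representation $$\mathcal I_{K,N,D}(v)=\begin{cases}f_{K,N,D}(a_{K,N,D}(v)) & \text{if }K\le0,\\ \inf_{D'\le D}f_{K,N,D'}(a_{K,N,D'}(v)) & \text{if }K>0.\end{cases}$$
   Context: Put $\kappa=K/(N-1)$ and $s_\kappa(\theta)=\frac{1}{\sqrt\kappa}\sin(\sqrt\kappa\,\theta)$ if $\kappa>0$, $s_0(\theta)=\theta$, $s_\kappa(\theta)=\frac1{\sqrt{-\kappa}}\sinh(\sqrt{-\kappa}\,\theta)$ if $\kappa<0$. For $t\in[0,1]$: $\sigma^{(t)}_{K,N-1}(0)=t$; $\sigma^{(t)}_{K,N-1}(\theta)=s_\kappa(t\theta)/s_\kappa(\theta)$ for $\theta>0$ (and $\theta<\pi/\sqrt\kappa$ if $\kappa>0$); $\sigma^{(t)}_{K,N-1}(\theta)=+\infty$ if $\kappa>0$ and $\theta\ge\pi/\sqrt\kappa$. For $D'>0$, a non-negative Borel function $h:[0,D']\to\mathbb R$ is an $\mathsf{MCP}(K,N)$-density if $h(tx_1+(1-t)x_0)\ge\sigma^{(1-t)}_{K,N-1}(|x_1-x_0|)^{N-1}h(x_0)$ for all $x_0,x_1\in[0,D']$, $t\in[0,1]$ (convention $\infty\cdot0=0$). Such densities are taken to be continuous up to the boundary. $\widetilde{\mathcal F}_{K,N,D'}$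 is the set of probability measures $\mu=h_\mu\mathcal L^1$ with $h_\mu:[0,D']\to\mathbb R$ an $\mathsf{MCP}(K,N)$-density, and $\mathcal F_{K,N,D}=\bigcup_{0<D'\le D}\widetilde{\mathcal F}_{K,N,D'}$. For a measure $\mu$ on $\mathbb R$, $\mu^+(A)=\liminf_{\varepsilon\to0^+}\frac{\mu(A^\varepsilon)-\mu(A)}{\varepsilon}$ with $A^\varepsilon=\{x:\mathrm{dist}(x,A)<\varepsilon\}$. The one-dimensional isoperimetric profile function is $$\mathcal I_{K,N,D}(v)=\inf\{\mu^+(A):A\subset[0,D]\text{ Borel},\ \mu(A)=v,\ \mu\in\mathcal F_{K,N,D}\}.$$ For $0<D'\le D$ and $a\in(0,D')$ put $$f_{K,N,D'}(a)=\Big(\int_0^a\Big(\tfrac{s_\kappa(D'-y)}{s_\kappa(D'-a)}\Big)^{N-1}dy+\int_a^{D'}\Big(\tfrac{s_\kappa(y)}{s_\kappa(a)}\Big)^{N-1}dy\Big)^{-1},$$ and let $h^a_{K,N,D'}:[0,D']\to\mathbb R$ be $f_{K,N,D'}(a)\big(\tfrac{s_\kappa(D'-x)}{s_\kappa(D'-a)}\big)^{N-1}$ for $x\le a$ and $f_{K,N,D'}(a)\big(\tfrac{s_\kappa(x)}{s_\kappa(a)}\big)^{N-1}$ for $x\ge a$. For $v\in(0,1)$, $a_{K,N,D'}(v)$ denotes the unique $a\in(0,D')$ with $\int_0^ah^a_{K,N,D'}(x)\,dx=v$. *)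

(* Defs.v *)
From mathcomp Require Import all_boot all_order all_algebra.
From mathcomp Require Import all_classical all_reals all_analysis.

Set Implicit Arguments.
Unset Strict Implicit.
Unset Printing Implicit Defensive.

Import Order.TTheory GRing.Theory Num.Theory.
Import numFieldNormedType.Exports.

Local Open Scope classical_set_scope.
Local Open Scope ring_scope.

Section MCP_isoperimetric_profile.
Context {R : realType}.
Implicit Types (K N D t theta a v x : R).

Definition sinh x : R := (expR x - expR (- x)) / 2.

Definition kappa K N : R := K / (N - 1).

Definition s_ (k theta : R) : R :=
  if 0 < k then sin (Num.sqrt k * theta) / Num.sqrt k
  else if k == 0 then theta
  else sinh (Num.sqrt (- k) * theta) / Num.sqrt (- k).

(* sigma K N t theta is $\sigma^{(t)}_{K,N-1}(\theta)$, for theta >= 0 *)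
Definition sigma K N t theta : \bar R :=
  let k := kappa K N in
  if theta == 0 then t%:E
  else if (0 < k) && (pi / Num.sqrt k <= theta) then +oo%E
  else (s_ k (t * theta) / s_ k theta)%:E.

(* Functions on [0, D] are represented by functions on R of which only the
   values on [0, D] matter. The product in \bar R satisfies +oo * 0 = 0. *)
Definition MCP_density K N D (h : R -> R) : Prop :=
  [/\ forall x, x \in `[0, D] -> 0 <= h x,
      measurable_fun `[0, D] h,
      {within `[0, D], continuous h} &
      forall x0 x1 t, x0 \in `[0, D] -> x1 \in `[0, D] -> t \in `[0, 1] ->
        (poweR (sigma K N (1 - t)%R `|x1 - x0|%R) (N - 1)%R * (h x0)%:E
         <= (h (t * x1 + (1 - t) * x0)%R)%:E)%E].

Definition F_tilde K N D : set (probability (measurableTypeR R) R) :=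
  [set mu | exists2 h : R -> R, MCP_density K N D h &
    forall A : set (measurableTypeR R), measurable A ->
      mu A = (\int[lebesgue_measure]_(x in A `&` `[0%R, D]) (h x)%:E)%E].

Definition F_ K N D : set (probability (measurableTypeR R) R) :=
  \bigcup_(D' in `]0, D]) F_tilde K N D'.

Definition enlargement (A : set R) (eps : R) : set R :=
  [set x | (edist_inf A x < eps%:E)%E].

Definition minkowski_content (mu : set R -> \bar R) (A : set R) : \bar R :=
  limf_einf (fun eps : R => ((mu (enlargement A eps) - mu A) / eps%:E)%E) 0^'+.

Definition isoperimetric_profile K N D v : \bar R :=
  ereal_inf [set m | exists (mu : probability (measurableTypeR R) R)
                            (A : set (measurableTypeR R)),
    [/\ F_ K N D mu, measurable A, A `<=` `[0, D], mu A = v%:E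
      & m = minkowski_content mu A]].

Definition f_ K N D a : R :=
  let s := s_ (kappa K N) in
  (\int[lebesgue_measure]_(y in `[0, a]) (s (D - y) / s (D - a)) `^ (N - 1) +
   \int[lebesgue_measure]_(y in `[a, D]) (s y / s a) `^ (N - 1))^-1.

Definition h_ K N D a x : R :=
  let s := s_ (kappa K N) in
  f_ K N D a * (if x <= a then (s (D - x) / s (D - a)) `^ (N - 1)
                else (s x / s a) `^ (N - 1)).

(* For v in (0, 1) there is exactly one such a, so that get returns it. *)
Definition a_ K N D v : R :=
  get [set a | 0 < a < D /\
    \int[lebesgue_measure]_(x in `[0, a]) h_ K N D a x = v].

End MCP_isoperimetric_profile.

(* Main.v *)
Require Import Defs.
From HB Require Import structures.
From mathcomp Require Import all_boot all_order all_algebra.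
From mathcomp Require Import all_classical all_reals all_analysis.
From mathcomp Require Import measurable_realfun ring lra.

(** Write [s] for the model function of curvature [kappa K N] and [p] for
[N - 1].

Half-lines.  Let [h] be an MCP density on [0, D'] and [a] an interior point.
Contracting towards the two endpoints bounds [h x] by [h a] times
[(s (D' - x) / s (D' - a)) ^ p] to the left of [a], and by [h a] times
[(s x / s a) ^ p] to its right.  Let [L a] and [R a] be the integrals of these
two functions, which are both values of [side_mass].  Then [h a * L a] and
[h a * R a] dominate the masses to the left and to the right of [a], while
[f_ K N D' a] is the inverse of [L a + R a], and [a_ K N D' w] is a point where
[f_ K N D' a * L a = w].  As [L] is nondecreasing and [R] nonincreasing, the
number [F w = f_ K N D' (a_ K N D' w)] is the least [y] for which
[w <= y * L a] and [1 - w <= y * R a] have a common solution [a]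
([profile_min]).  Hence [h x] is at least [F] of the mass of the half-line that
ends at [x].

Borel sets.  The minimality of [F w] also yields that [F (1 - w) = F w] and that
[F w / w] is nonincreasing ([profile_sym], [profile_ratio_anti]).  These two
properties make [F] subadditive, for differences of masses as well as for sums.
They lead from half-lines to Borel sets as follows ([thickening_bound]).  If a
set has no gap of length [2 * e], its [e]-thickening is an interval and adds to
it two pieces of length [e], whose masses are bounded below by the inequality
for half-lines.  A gap of length [2 * e] splits both the set and its thickening,
and the two bounds are added.  The error is a factor that depends only on the
total mass added, so it disappears in the limit.

Attainment.  By Ptolemy's identity for [s], the function [h_ K N D' a] is an MCP
density; for [a = a_ K N D' v] the segment [0, a] has mass [v], and its content
is at most the value [F v] of the density at [a].  So the profile at [v] is the
infimum over [D' <= D] of the numbers [F v].  If [K <= 0], then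
[s (l * x) / s x] is nondecreasing in [x] for [1 <= l], and therefore dilating
[0, D'] onto [0, D] increases both [L] and [R] and lowers [F v]
([profile_diam_anti]): the infimum is the value at [D' = D]. *)

Set Implicit Arguments.
Unset Strict Implicit.
Unset Printing Implicit Defensive.

Import Order.TTheory GRing.Theory Num.Theory.
Import numFieldNormedType.Exports.

Local Open Scope classical_set_scope.
Local Open Scope ring_scope.

(** * The model functions of constant curvature *)

Section model_function.
Context {R : realType}.
Implicit Types (k x y A B C l D : R).

(** The Bonnet-Myers bound: [s_ k] is positive inside such a segment. *)
Definition in_model_range k D := 0 < k -> D <= pi / Num.sqrt k.

Lemma sin_ptolemy A B C :
  sin (A + B) * sin (B + C) = sin A * sin C + sin B * sin (A + B + C) :> R.
Proof.
rewrite !sinD !cosD.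
have := cos2Dsin2 B => e.
transitivity (sin A * sin C * (cos B ^+ 2 + sin B ^+ 2) +
 sin B * ((sin A * cos B + cos A * sin B) * cos C + (cos A * cos B - sin A * sin B) * sin C)).
  by ring.
by rewrite e; ring.
Qed.

Lemma sinh_ptolemy A B C :
  sinh (A + B) * sinh (B + C) = sinh A * sinh C + sinh B * sinh (A + B + C) :> R.
Proof.
rewrite /sinh !opprD !expRD !expRN.
field.
by rewrite !expR_eq0.
Qed.

(** Ptolemy's theorem for four points on a geodesic, in a form common to the
three signs of the curvature.  The monotonicity of the ratios of [s_] and the
MCP inequality of the model densities are both read off from it. *)
Lemma sk_ptolemy k A B C :
  s_ k (A + B) * s_ k (B + C) = s_ k A * s_ k C + s_ k B * s_ k (A + B + C).
Proof.
pose H (f : R -> R) := forall A B C, f (A + B) * f (B + C) = f A * f C + f B * f (A + B + C).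
have Hscale f c i : H f -> forall A B C,
    f (c * (A + B)) * i * (f (c * (B + C)) * i) =
    f (c * A) * i * (f (c * C) * i) + f (c * B) * i * (f (c * (A + B + C)) * i).
  move=> Hf A' B' C'; rewrite mulrACA [c * (A' + B')]mulrDr [c * (B' + C')]mulrDr Hf.
  by rewrite [c * (A' + B' + C')]mulrDr [c * (A' + B')]mulrDr; ring.
rewrite /s_; case: ifPn => [k0|_]; [|case: ifPn => [_|_]].
- exact: (Hscale sin _ _ sin_ptolemy).
- by ring.
- exact: (Hscale sinh _ _ sinh_ptolemy).
Qed.

Lemma sinh0 : sinh 0 = 0 :> R.
Proof. by rewrite /sinh oppr0 subrr mul0r. Qed.

Lemma sinh_gt0 x : 0 < x -> 0 < sinh x.
Proof.
by move=> x0; rewrite /sinh divr_gt0// subr_gt0 ltr_expR; lra.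
Qed.

Lemma sk0 k : s_ k 0 = 0.
Proof. by rewrite /s_ !mulr0 sin0 sinh0 !mul0r; case: ifP => _ //; case: ifP. Qed.

Lemma sk_gt0 k x : 0 < x -> (0 < k -> x < pi / Num.sqrt k) -> 0 < s_ k x.
Proof.
move=> x0 xk; rewrite /s_; case: ifPn => [k0|]; [|case: ifPn => //].
  have sk0 : 0 < Num.sqrt k by rewrite sqrtr_gt0.
  rewrite divr_gt0// sin_gt0_pi// mulr_gt0//=.
  by rewrite mulrC -ltr_pdivlMr// xk.
move=> kN0; rewrite -leNgt => k0.
have sk0 : 0 < Num.sqrt (- k) by rewrite sqrtr_gt0 oppr_gt0 lt_neqAle kN0.
by rewrite divr_gt0// sinh_gt0// mulr_gt0.
Qed.

Lemma sk_pi k : 0 < k -> s_ k (pi / Num.sqrt k) = 0.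
Proof.
move=> k0; rewrite /s_ k0 [Num.sqrt k * _]mulrC divfK ?sinpi ?mul0r//.
by rewrite gt_eqF// sqrtr_gt0.
Qed.

Lemma sk_ge0 k x : 0 <= x -> in_model_range k x -> 0 <= s_ k x.
Proof.
rewrite le_eqVlt => /predU1P[<-|x0] kx; first by rewrite sk0.
have [k0|k0] := ltP 0 k; last first.
  by apply/ltW/sk_gt0 => //; rewrite ltNge k0.
have := kx k0; rewrite le_eqVlt => /predU1P[->|xk]; first by rewrite sk_pi.
by apply/ltW/sk_gt0.
Qed.

Lemma sk_lt_gt0 k x D : in_model_range k D -> 0 < x -> x < D -> 0 < s_ k x.
Proof.
move=> kD x0 xD; apply: sk_gt0 => // k0; exact: lt_le_trans (kD k0).
Qed.

Lemma sk_le_ge0 k x D : in_model_range k D -> 0 <= x -> x <= D -> 0 <= s_ k x.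
Proof.
move=> kD x0 xD; apply: sk_ge0 => // k0; exact: le_trans (kD k0).
Qed.

Lemma continuous_sinh : continuous (@sinh R).
Proof.
move=> x; rewrite /sinh; apply: cvgM; last exact: cvg_cst.
apply: cvgB; first exact: continuous_expR.
apply: (@continuous_comp _ _ _ (-%R) expR).
  exact: opp_continuous.
exact: continuous_expR.
Qed.

Lemma continuous_sk k : continuous (s_ k).
Proof.
have Hscale (f : R -> R) c i : continuous f -> continuous (fun x => f (c * x) * i).
  move=> cf x; apply: cvgM; last exact: cvg_cst.
  apply: (@continuous_comp _ _ _ ( *%R c) f); last exact: cf.
  exact: mulrl_continuous.
case E : (0 < k); [|case E0 : (k == 0)].
- rewrite (_ : s_ k = fun x => sin (Num.sqrt k * x) / Num.sqrt k).
    exact/Hscale/continuous_sin.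
  by apply/funext => x; rewrite /s_ E.
- rewrite (_ : s_ k = id); first by move=> x; exact: cvg_id.
  by apply/funext => x; rewrite /s_ E E0.
- rewrite (_ : s_ k = fun x => sinh (Num.sqrt (- k) * x) / Num.sqrt (- k)).
    exact/Hscale/continuous_sinh.
  by apply/funext => x; rewrite /s_ E E0.
Qed.

(** By Ptolemy's identity, the two cross products differ by
[s_ k w * s_ k (b' - b)]. *)
Lemma sk_ratio_anti k w b b' : 0 <= w -> 0 < b -> b <= b' ->
  in_model_range k (b' + w) -> 0 < s_ k b' ->
  0 <= s_ k (b' + w) / s_ k b' <= s_ k (b + w) / s_ k b.
Proof.
move=> w0 b0 bb' kb sb'.
have sb : 0 < s_ k b.
  move: bb'; rewrite le_eqVlt => /predU1P[->//|bb'].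
  by apply: (sk_lt_gt0 kb); lra.
have sbw : 0 <= s_ k (b' + w) by apply: (sk_le_ge0 kb); lra.
rewrite divr_ge0 ?(ltW sb')//=.
rewrite ler_pdivlMr// mulrAC ler_pdivrMr//.
have := sk_ptolemy k w b (b' - b).
rewrite [w + b]addrC (_ : b + (b' - b) = b'); last by ring.
rewrite (_ : b + w + (b' - b) = b' + w); last by ring.
move=> ->; rewrite [X in _ <= X]addrC [s_ k (b' + w) * _]mulrC lerDl.
by apply: mulr_ge0; apply: (sk_le_ge0 kb); lra.
Qed.

Definition cosh x : R := (expR x + expR (- x)) / 2.

Lemma is_derive_sinh x : is_derive x 1 (@sinh R) (cosh x).
Proof.
apply: (@is_derive_eq _ _ _ (fun x => (expR x - expR (- x)) / 2)).
by rewrite /cosh /GRing.scale/=; ring.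
Qed.

Lemma is_derive_cosh x : is_derive x 1 (@cosh) (sinh x).
Proof.
apply: (@is_derive_eq _ _ _ (fun x => (expR x + expR (- x)) / 2)).
by rewrite /sinh /GRing.scale/=; ring.
Qed.

End model_function.

(** * Dilations in non-positive curvature *)

Section dilation.
Context {R : realType}.
Implicit Types (k x y A B C l D w b : R).

Lemma is_derive_ge0_ndecr (f df : R -> R) x0 :
  (forall x, x0 <= x -> is_derive x 1 f (df x)) ->
  (forall x, x0 <= x -> 0 <= df x) ->
  forall x y, x0 <= x -> x <= y -> f x <= f y.
Proof.
move=> fdf df0 x y x0x xy.
apply: (@ger0_derive1_ndecry R f x0) => //.
- by move=> z; rewrite in_itv/= andbT => /ltW /fdf [].
- move=> z; rewrite in_itv/= andbT => /ltW z0.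
  by rewrite derive1E; have [_ ->] := fdf _ z0; exact: df0.
- apply: derivable_within_continuous => z; rewrite in_itv/= andbT => z0.
  by have [] := fdf _ z0.
Qed.

Lemma sinh_ge0 x : 0 <= x -> 0 <= sinh x.
Proof. by rewrite le_eqVlt => /predU1P[<-|/sinh_gt0/ltW//]; rewrite sinh0. Qed.

Lemma is_derive_sinhM l x : is_derive x 1 (fun x => sinh (l * x)) (l * cosh (l * x)).
Proof.
have h1 : is_derive (l * x) 1 sinh (cosh (l * x)) := is_derive_sinh _.
have h2 : is_derive x 1 ( *%R l) l.
  by apply: is_derive_eq; rewrite /GRing.scale/= mulr1.
by apply: is_derive_eq; rewrite mulrC.
Qed.

Lemma is_derive_coshM l x : is_derive x 1 (fun x => cosh (l * x)) (l * sinh (l * x)).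
Proof.
have h1 : is_derive (l * x) 1 cosh (sinh (l * x)) := is_derive_cosh _.
have h2 : is_derive x 1 ( *%R l) l.
  by apply: is_derive_eq; rewrite /GRing.scale/= mulr1.
by apply: is_derive_eq; rewrite mulrC.
Qed.

(** The numerator of the derivative of [sinh (l * x) / sinh x].  It vanishes at
0, and its own derivative is [(l ^ 2 - 1) * sinh (l * x) * sinh x]. *)
Lemma sinh_scale_wronskian l x : 1 <= l -> 0 <= x ->
  0 <= l * cosh (l * x) * sinh x - sinh (l * x) * cosh x.
Proof.
move=> l1 x0.
pose f x := l * cosh (l * x) * sinh x - sinh (l * x) * cosh x.
have f0 : f 0 = 0 by rewrite /f !mulr0 sinh0; ring.
rewrite -[leLHS]f0.
apply: (@is_derive_ge0_ndecr f (fun x => (l ^+ 2 - 1) * (sinh (l * x) * sinh x)) 0) => //.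
  move=> z _.
  have h1 := is_derive_sinhM l z.
  have h2 := is_derive_coshM l z.
  have h3 := is_derive_sinh z.
  have h4 := is_derive_cosh z.
  apply: is_derive_eq.
  rewrite /GRing.scale/=; ring.
move=> z z0; apply: mulr_ge0; first by nra.
by apply: mulr_ge0; apply: sinh_ge0 => //; nra.
Qed.

Lemma sinh_scale_ratio l b x : 1 <= l -> 0 < b -> b <= x ->
  sinh x / sinh b <= sinh (l * x) / sinh (l * b).
Proof.
move=> l1 b0 bx.
have sgt y : b <= y -> 0 < sinh y by move=> by'; apply: sinh_gt0; lra.
have sb := sgt _ (lexx b); have sx := sgt _ bx.
have slb : 0 < sinh (l * b) by apply: sinh_gt0; nra.
pose f x := sinh (l * x) / sinh x.
pose df x := (l * cosh (l * x) * sinh x - sinh (l * x) * cosh x) / sinh x ^+ 2.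
have fle : f b <= f x.
  apply: (@is_derive_ge0_ndecr f df b _ _ _ _ (lexx b) bx) => z bz.
    have h1 := is_derive_sinhM l z.
    have h3 := is_derive_sinh z.
    have sz : sinh z != 0 by rewrite gt_eqF// sgt.
    have h4 := is_deriveV sz h3.
    apply: is_derive_eq.
    by rewrite /df /GRing.scale/=; field.
  apply: divr_ge0; last exact: sqr_ge0.
  by apply: sinh_scale_wronskian => //; lra.
move: fle; rewrite /f ler_pdivrMr// mulrAC ler_pdivlMr// => fle.
by rewrite ler_pdivrMr// mulrAC ler_pdivlMr// mulrC.
Qed.

(** Dilations spread out the model functions of non-positive curvature; in
positive curvature the inequality is reversed. *)
Lemma sk_scale_ratio k l b x : k <= 0 -> 1 <= l -> 0 < b -> b <= x ->
  s_ k x / s_ k b <= s_ k (l * x) / s_ k (l * b).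
Proof.
move=> k0 l1 b0 bx; rewrite /s_ ltNge k0/=; case: ifPn => [_|kN0].
  by rewrite -mulf_div divff ?mul1r//; lra.
have r0 : 0 < Num.sqrt (- k) by rewrite sqrtr_gt0 oppr_gt0 lt_neqAle kN0.
set r := Num.sqrt _ in r0 *.
have rK A B : A / r / (B / r) = A / B.
  by rewrite -mulf_div invrK mulVf ?mulr1// gt_eqF.
rewrite !rK !(mulrCA _ l).
apply: sinh_scale_ratio => //; first by rewrite mulr_gt0.
by rewrite ler_pM2l.
Qed.

End dilation.

(** * Integrals of continuous functions over segments *)

Section segment_integrals.
Context {R : realType}.
Implicit Types (a b c l p u x y : R) (f g : R -> R).

Local Notation mu := (@lebesgue_measure R).

(** Truncation at 0 makes the power continuous on the whole line, whereas [powR]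
maps negative numbers to 1.  The two agree wherever a model function is
non-negative. *)
Definition pospow p u : R := (Num.max 0 u) `^ p.

Lemma pospowE p u : 0 <= u -> pospow p u = u `^ p.
Proof. by move=> u0; rewrite /pospow max_r. Qed.

Lemma continuous_pospow p : 0 < p -> continuous (pospow p).
Proof.
move=> p0 x; apply/cvgrPdist_lt => e e0.
have [x0|x0|<-] := ltgtP 0 x.
- have cx : {for x, continuous (fun u => expR (p * ln u))}.
    apply: (@continuous_comp _ _ _ (fun u => p * ln u) expR).
      by apply: cvgM; [exact: cvg_cst|exact: continuous_ln].
    exact: continuous_expR.
  have /cvgrPdist_lt/(_ e e0) H := cx.
  near=> u.
  have u0 : 0 < u by near: u; exact: lt_nbhsr.
  rewrite !pospowE ?ltW// /powR !gt_eqF//.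
  by near: u; exact: H.
- near=> u.
  have u0 : u < 0 by near: u; exact: lt_nbhsl.
  by rewrite /pospow !max_l ?ltW// subrr normr0.
(* This [d] is the radius within which [u `^ p < e]. *)
- pose d := e `^ p^-1.
  have d0 : 0 < d by exact: powR_gt0.
  near=> u.
  have ud : u < d by near: u; exact: lt_nbhsl.
  rewrite {1}/pospow max_l// powR0 ?gt_eqF// sub0r normrN ger0_norm ?powR_ge0//.
  have -> : e = d `^ p by rewrite /d -powRrM mulVf ?powRr1 ?ltW// gt_eqF.
  rewrite /pospow; apply: gt0_ltr_powR => //; rewrite ?nnegrE ?(ltW d0)//.
    by rewrite le_max lexx.
  by rewrite gt_max d0.
Unshelve. all: by end_near. Qed.

Lemma pospow_ge0 p y : 0 <= pospow p y.
Proof. exact: powR_ge0. Qed.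

Lemma le_pospow p x y : 0 <= p -> x <= y -> pospow p x <= pospow p y.
Proof.
move=> p0 xy.
have max_ge0 (z : R) : Num.max 0 z \is Num.nneg by rewrite nnegrE le_max lexx.
apply: ge0_ler_powR => //.
by rewrite ge_max !le_max lexx xy orbT.
Qed.

Lemma pospow_div p x y : 0 <= x -> 0 < y ->
  pospow p (x / y) * pospow p y = pospow p x.
Proof.
move=> x0 y0; have xy0 : 0 <= x / y by rewrite divr_ge0// ltW.
rewrite (pospowE _ xy0) (pospowE _ (ltW y0)) (pospowE _ x0).
by rewrite -powRM ?(ltW y0)// divfK// gt_eqF.
Qed.

Lemma pospow_gt0 p (u : R) : 0 < u -> 0 < pospow p u.
Proof. by move=> u0; rewrite pospowE ?ltW// powR_gt0. Qed.

Definition itv_int f a b : R := \int[mu]_(x in `[a, b]) f x.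

Lemma continuous_integrable_itv f a b : continuous f ->
  mu.-integrable `[a, b] (EFin \o f).
Proof.
move=> cf; apply: continuous_compact_integrable; first exact: segment_compact.
exact: continuous_subspaceT.
Qed.

Lemma EFin_itv_int f a b : continuous f ->
  (itv_int f a b)%:E = (\int[mu]_(x in `[a, b]) (f x)%:E)%E.
Proof.
move=> cf; rewrite /itv_int /Rintegral fineK//.
by apply: integrable_fin_num => //; exact: continuous_integrable_itv.
Qed.

Lemma eq_itv_int f g a b : (forall x, a <= x -> x <= b -> f x = g x) ->
  itv_int f a b = itv_int g a b.
Proof.
move=> fg; apply: eq_Rintegral => x; rewrite inE/= in_itv/= => /andP[ax xb].
exact: fg.
Qed.

Lemma le_itv_int f g a b : continuous f -> continuous g ->
  (forall x, a <= x -> x <= b -> f x <= g x) -> itv_int f a b <= itv_int g a b.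
Proof.
move=> cf cg fg; apply: le_Rintegral => //; try exact: continuous_integrable_itv.
by move=> x; rewrite /= in_itv/= => /andP[]; exact: fg.
Qed.

Lemma itv_int_ge0 f a b : (forall x, a <= x -> x <= b -> 0 <= f x) -> 0 <= itv_int f a b.
Proof.
move=> f0; apply: Rintegral_ge0 => x; rewrite /= in_itv/= => /andP[]; exact: f0.
Qed.

Lemma itv_int_cat f a b c : continuous f -> a <= b -> b <= c ->
  itv_int f a c = itv_int f a b + itv_int f b c.
Proof.
move=> cf ab bc.
have := @Rintegral_itvB R f (BLeft a) (BRight c) b (continuous_integrable_itv _ _ cf).
rewrite !bnd_simp => /(_ ab bc) H.
rewrite /itv_int -[X in _ = _ + X]Rintegral_itv_obnd_cbnd; last first.
  apply: integrableS (continuous_integrable_itv b c cf) => //.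
  exact: subset_itv_oc_cc.
by rewrite -H; ring.
Qed.

Lemma itv_intZ f c a b : continuous f -> itv_int (fun x => c * f x) a b = c * itv_int f a b.
Proof. by move=> cf; apply: RintegralZl => //; exact: continuous_integrable_itv. Qed.

Lemma itv_int_cst c a b : a <= b -> itv_int (cst c) a b = c * (b - a).
Proof.
move=> ab; rewrite /itv_int Rintegral_cst//=.
rewrite lebesgue_measure_itv/= lte_fin.
by move: ab; rewrite le_eqVlt => /predU1P[->|->]; rewrite ?ltxx ?subrr.
Qed.

Lemma itv_int_affine f l c a b : 0 < l -> a <= b -> continuous f ->
  itv_int f (l * a + c) (l * b + c) = l * itv_int (fun x => f (l * x + c)) a b.
Proof.
move=> l0 ab cf.
have caff : continuous (fun x => l * x + c).
  by move=> x; apply: cvgD; [exact: mulrl_continuous|exact: cvg_cst].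
have cfaff : continuous (fun x => f (l * x + c)).
  by move=> x; exact: (continuous_comp (caff x) (cf _)).
have daff x : is_derive x 1 (fun x => l * x + c) l.
  have h2 : is_derive x 1 ( *%R l) l.
    by apply: is_derive_eq; rewrite /GRing.scale/= mulr1.
  by apply: is_derive_eq; rewrite addr0.
have deriveaff : derive1 (fun x => l * x + c) = cst l.
  by apply/funext => x; rewrite derive1E; have [] := daff x.
apply: EFin_inj; rewrite EFin_itv_int// EFinM EFin_itv_int// -integralZl//; last first.
  exact: continuous_integrable_itv.
rewrite (@integration_by_substitution_increasing R (fun x => l * x + c) f a b)//.
- rewrite deriveaff; apply: eq_integral => x _ /=.
  by rewrite -EFinM mulrC.
- by move=> x y _ _ xy; rewrite ltrD2r ltr_pM2l.
- by rewrite deriveaff => x _; exact: cvg_cst.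
- by rewrite deriveaff; exact: is_cvg_cst.
- by rewrite deriveaff; exact: is_cvg_cst.
- split.
  + by move=> x _; have [] := daff x.
  + exact/cvg_at_right_filter/caff.
  + exact/cvg_at_left_filter/caff.
- exact: continuous_subspaceT.
Qed.

Lemma itv_int_opp f a b : a <= b -> continuous f ->
  itv_int f (- b) (- a) = itv_int (fun x => f (- x)) a b.
Proof.
move=> ab cf; apply: EFin_inj; rewrite !EFin_itv_int//; last first.
  by move=> x; apply: (@continuous_comp _ _ _ -%R f); [exact: opp_continuous|exact: cf].
by rewrite integration_by_substitution_oppr//; exact: continuous_subspaceT.
Qed.

Lemma itv_int_shift f c a b : a <= b -> continuous f ->
  itv_int f (a + c) (b + c) = itv_int (fun x => f (x + c)) a b.
Proof.
move=> ab cf; have := @itv_int_affine f 1 c a b ltr01 ab cf.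
rewrite !mul1r => ->; apply: eq_itv_int => x _ _; by rewrite mul1r.
Qed.

Lemma itv_int_reflect f c a b : a <= b -> continuous f ->
  itv_int f (c - b) (c - a) = itv_int (fun x => f (c - x)) a b.
Proof.
move=> ab cf; rewrite ![c - _]addrC itv_int_shift//; last by rewrite lerN2.
rewrite itv_int_opp//; first by apply: eq_itv_int => x _ _; rewrite addrC.
move=> x; apply: (@continuous_comp _ _ _ (+%R^~ c) f); last exact: cf.
by apply: cvgD; [exact: cvg_id|exact: cvg_cst].
Qed.

Lemma continuous_itv_int f a b : a <= b -> continuous f ->
  {within `[a, b], continuous (fun x => itv_int f a x)}.
Proof.
move=> ab cf; apply: parameterized_integral_continuous => //.
exact: continuous_integrable_itv.
Qed.

End segment_integrals.

(** * Mass of the model densities on either side of the base point *)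

(* From here on the identities above are used, not the defining formulas. *)
Opaque s_ pospow itv_int.

Section side_mass.
Context {R : realType}.
Implicit Types (a b k p l D v w y : R) (f g : R -> R).

Lemma itv_int_gt0 f a : continuous f -> 0 < a ->
  (forall x, 0 <= x -> x <= a -> 0 <= f x) -> 0 < f 0 -> 0 < itv_int f 0 a.
Proof.
move=> cf a0 f0 f00.
have /cvgrPdist_lt/(_ (f 0 / 2)) := cf 0.
rewrite divr_gt0// => /(_ isT)[e/= e0 He].
pose d := Num.min a (e / 2).
have d0 : 0 < d by rewrite lt_min a0 divr_gt0.
have da : d <= a by rewrite ge_min lexx.
have de : d < e by rewrite gt_min; apply/orP; right; lra.
rewrite (itv_int_cat cf (ltW d0) da) ltr_wpDr//.
  by apply: itv_int_ge0 => x dx xa; apply: f0 => //; exact: le_trans (ltW d0) dx.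
apply: (@lt_le_trans _ _ (itv_int (cst (f 0 / 2)) 0 d)).
  by rewrite itv_int_cst ?ltW// mulr_gt0 ?divr_gt0// subr0.
apply: le_itv_int => // [x|x x0 xd]; first exact: cvg_cst.
have /= := He x; rewrite sub0r normrN ger0_norm// => /(_ (le_lt_trans xd de)).
by rewrite ltr_norml => /andP[_]; lra.
Qed.

Lemma itv_int_small f e : continuous f -> 0 < e ->
  exists2 d, 0 < d & forall x, 0 <= x -> x <= d -> itv_int f 0 x <= e.
Proof.
move=> cf e0.
have /cvgrPdist_lt/(_ 1 ltr01)[r/= r0 Hr] := cf 0.
pose C := `|f 0| + 1.
have C0 : 0 < C by rewrite ltr_wpDl.
exists (Num.min (r / 2) (e / C)).
  by rewrite lt_min !divr_gt0.
move=> x x0; rewrite le_min => /andP[xr xe].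
apply: (@le_trans _ _ (itv_int (cst C) 0 x)); last first.
  by rewrite itv_int_cst// subr0 mulrC -ler_pdivlMr.
apply: le_itv_int => // [y|y y0 yx]; first exact: cvg_cst.
have /= := Hr y; rewrite sub0r normrN ger0_norm// => /(_ ltac:(lra)).
rewrite ltr_norml => /andP[+ _]; rewrite /C.
have := ler_norm (f 0); lra.
Qed.

(** Start at a point at distance [b] from one end of the segment and move away
from that end by [w <= a]: the integrand is the model density normalized to 1
at the starting point.  In this form the left and the right side of a base
point are visibly symmetric. *)
Definition side_mass k p a b : R :=
  itv_int (fun w => pospow p (s_ k (b + w) / s_ k b)) 0 a.

Lemma continuous_sk_affine k p (l c i : R) : 0 < p ->
  continuous (fun x => pospow p (s_ k (l * x + c) * i)).
Proof.
move=> p0 x.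
apply: (@continuous_comp _ _ _ (fun x => s_ k (l * x + c) * i) (pospow p));
  last exact: continuous_pospow.
apply: cvgM; last exact: cvg_cst.
apply: (@continuous_comp _ _ _ (fun x => l * x + c) (s_ k)); last exact: continuous_sk.
by apply: cvgD; [exact: mulrl_continuous|exact: cvg_cst].
Qed.

Lemma continuous_side_mass_integrand k p b : 0 < p ->
  continuous (fun w => pospow p (s_ k (b + w) / s_ k b)).
Proof.
move=> p0; rewrite (_ : (fun _ => _) = fun w => pospow p (s_ k (1 * w + b) / s_ k b)).
  exact: continuous_sk_affine.
by apply/funext => w; rewrite mul1r addrC.
Qed.

Lemma side_mass_gt0 k p a b : 0 < p -> 0 < a -> 0 < s_ k b -> 0 < side_mass k p a b.
Proof.
move=> p0 a0 sb; apply: itv_int_gt0 => //; first exact: continuous_side_mass_integrand.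
  by move=> x _ _; exact: pospow_ge0.
by rewrite addr0 divff ?gt_eqF// pospowE// powR1.
Qed.

(** The integrand is nonincreasing in [b] by [sk_ratio_anti]. *)
Lemma le_side_mass k p a a' b b' : 0 < p -> 0 <= a -> a <= a' ->
  0 < b' -> b' <= b -> in_model_range k (b + a) -> 0 < s_ k b ->
  side_mass k p a b <= side_mass k p a' b'.
Proof.
move=> p0 a0 aa' b0 bb' kb sb.
have ci := @continuous_side_mass_integrand k p _ p0.
rewrite [leRHS](itv_int_cat (ci b') a0 aa').
apply: (@le_trans _ _ (itv_int (fun w => pospow p (s_ k (b' + w) / s_ k b')) 0 a)).
  apply: (le_itv_int (ci b) (ci b')) => w w0 wa; apply: (le_pospow (ltW p0)).
  suff /andP[] : 0 <= s_ k (b + w) / s_ k b <= s_ k (b' + w) / s_ k b' by [].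
  by apply: (sk_ratio_anti w0 b0 bb' _ sb) => k0; apply: le_trans (kb k0); lra.
by rewrite lerDl; apply: itv_int_ge0 => *; exact: pospow_ge0.
Qed.

Lemma le_side_mass_scale k p l a b : 0 < p -> k <= 0 -> 1 <= l -> 0 < a -> 0 < b ->
  side_mass k p a b <= side_mass k p (l * a) (l * b).
Proof.
move=> p0 k0 l1 a0 b0.
have l0 : 0 < l by lra.
have ci b := @continuous_side_mass_integrand k p b p0.
pose g x := pospow p (s_ k (l * b + (l * x + 0)) / s_ k (l * b)).
have cg : continuous g.
  rewrite (_ : g = (fun x => pospow p (s_ k (l * x + l * b) / s_ k (l * b)))).
    exact: continuous_sk_affine.
  by apply/funext => x; rewrite /g addr0 addrC.
have -> : side_mass k p (l * a) (l * b) = l * itv_int g 0 a.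
  have := @itv_int_affine R _ l 0 0 a l0 (ltW a0) (ci (l * b)).
  by rewrite [l * 0 + 0]addr0 mulr0 [l * a + 0]addr0.
apply: (@le_trans _ _ (itv_int g 0 a)).
  apply: (le_itv_int (ci b) cg) => x x0 xa; apply: (le_pospow (ltW p0)).
  by rewrite addr0 -mulrDr; apply: sk_scale_ratio => //; lra.
by rewrite ler_peMl//; apply: itv_int_ge0 => *; exact: pospow_ge0.
Qed.

Lemma itv_int_left_side_mass k p D a : 0 < p -> 0 <= a ->
  itv_int (fun y => pospow p (s_ k (D - y) / s_ k (D - a))) 0 a = side_mass k p a (D - a).
Proof.
move=> p0 a0.
have := @itv_int_reflect R (fun y => pospow p (s_ k (D - y) / s_ k (D - a))) a 0 a a0.
rewrite subrr subr0 => ->.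
  by apply: eq_itv_int => x _ _; congr (pospow _ (s_ _ _ / _)); ring.
rewrite (_ : (fun _ => _) = (fun x => pospow p (s_ k (-1 * x + D) / s_ k (D - a)))).
  exact: continuous_sk_affine.
by apply/funext => x; rewrite mulN1r addrC.
Qed.

Lemma itv_int_right_side_mass k p D a : 0 < p -> a <= D ->
  itv_int (fun y => pospow p (s_ k y / s_ k a)) a D = side_mass k p (D - a) a.
Proof.
move=> p0 aD.
set f := (fun y => _).
have cf : continuous f.
  rewrite (_ : f = (fun x => pospow p (s_ k (1 * x + 0) / s_ k a))).
    exact: continuous_sk_affine.
  by apply/funext => x; rewrite mul1r addr0.
have aD0 : 0 <= D - a by rewrite subr_ge0.
have := itv_int_shift a aD0 cf.
rewrite [0 + a]add0r [D - a + a]subrK => ->.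
by apply: eq_itv_int => x _ _; rewrite /f addrC.
Qed.

Opaque side_mass.

Section fixed_diameter.
Variables (k p D : R).
Hypotheses (p0 : 0 < p) (D0 : 0 < D) (kD : in_model_range k D).

Let s_gt0 a : 0 < a -> a < D -> 0 < s_ k a.
Proof. exact: sk_lt_gt0. Qed.

Lemma side_mass_left_gt0 a : 0 < a -> a < D -> 0 < side_mass k p a (D - a).
Proof. by move=> a0 aD; apply: side_mass_gt0 => //; apply: s_gt0; lra. Qed.

Lemma side_mass_right_gt0 a : 0 < a -> a < D -> 0 < side_mass k p (D - a) a.
Proof. by move=> a0 aD; apply: side_mass_gt0 => //; [lra|exact: s_gt0]. Qed.

Lemma le_side_mass_left a a' : 0 < a -> a <= a' -> a' < D ->
  side_mass k p a (D - a) <= side_mass k p a' (D - a').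
Proof.
move=> a0 aa' aD; apply: le_side_mass => //; try lra.
  by rewrite subrK.
by apply: s_gt0; lra.
Qed.

Lemma le_side_mass_right a a' : 0 < a -> a <= a' -> a' < D ->
  side_mass k p (D - a') a' <= side_mass k p (D - a) a.
Proof.
move=> a0 aa' aD; apply: le_side_mass => //; try lra.
  by rewrite subrKC.
by apply: s_gt0; lra.
Qed.

Lemma side_mass_left_small e : 0 < e ->
  exists a, [/\ 0 < a, a <= D / 2 & side_mass k p a (D - a) <= e].
Proof.
move=> e0.
have [d d0 Hd] := itv_int_small (@continuous_side_mass_integrand k p (D / 2) p0) e0.
exists (Num.min d (D / 2)); split.
- by rewrite lt_min d0 divr_gt0.
- by rewrite ge_min lexx orbT.
apply: (@le_trans _ _ (side_mass k p (Num.min d (D / 2)) (D / 2))).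
  have h1 : 0 < Num.min d (D / 2) by rewrite lt_min d0 divr_gt0.
  have h2 : Num.min d (D / 2) <= D / 2 by rewrite ge_min lexx orbT.
  apply: le_side_mass => //; try lra.
    by rewrite subrK.
  by apply: s_gt0; lra.
apply: Hd.
  by rewrite le_min ltW//= divr_ge0// ltW.
by rewrite ge_min lexx.
Qed.

(** As [a] tends to 0 the left mass tends to 0, while the right one stays above
its value at the midpoint. *)
Lemma side_mass_balance_left v : 0 < v -> v < 1 ->
  exists a, [/\ 0 < a, a <= D / 2 &
    (1 - v) * side_mass k p a (D - a) <= v * side_mass k p (D - a) a].
Proof.
move=> v0 v1.
have R0 : 0 < side_mass k p (D - D / 2) (D / 2) by apply: side_mass_right_gt0; have := D0; lra.
have := @side_mass_left_small (v * side_mass k p (D - D / 2) (D / 2) / (1 - v)).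
rewrite divr_gt0 ?mulr_gt0 ?subr_gt0// => /(_ isT)[a [a0 aD La]].
have v1' : 0 < 1 - v by rewrite subr_gt0.
exists a; split; [exact: a0|exact: aD|].
move: La; rewrite (ler_pdivlMr _ _ v1') mulrC => La.
apply: (le_trans La); rewrite (ler_pM2l v0); apply: (le_side_mass_right a0 aD).
by rewrite ltr_pdivrMr// ltr_pMr// ltr1n.
Qed.

Let left_side_massE a : 0 < a -> a < D -> side_mass k p a (D - a) * pospow p (s_ k (D - a)) =
  itv_int (fun y => pospow p (s_ k (-1 * y + D) * 1)) 0 a.
Proof.
move=> a0 aD; rewrite -itv_int_left_side_mass ?(ltW a0)// mulrC -itv_intZ; last first.
  rewrite (_ : (fun _ => _) = (fun x => pospow p (s_ k (-1 * x + D) / s_ k (D - a)))).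
    exact: continuous_sk_affine.
  by apply/funext => x; rewrite mulN1r addrC.
apply: eq_itv_int => x x0 xa; rewrite mulrC pospow_div.
- by rewrite mulr1 mulN1r addrC.
- by apply: (sk_le_ge0 kD); lra.
- by apply: s_gt0; lra.
Qed.

Let right_side_massE a : 0 < a -> a < D -> side_mass k p (D - a) a * pospow p (s_ k a) =
  itv_int (fun y => pospow p (s_ k (1 * y + 0) * 1)) a D.
Proof.
move=> a0 aD; rewrite -itv_int_right_side_mass ?(ltW aD)// mulrC -itv_intZ; last first.
  rewrite (_ : (fun _ => _) = (fun x => pospow p (s_ k (1 * x + 0) / s_ k a))).
    exact: continuous_sk_affine.
  by apply/funext => x; rewrite mul1r addr0.
apply: eq_itv_int => x x0 xa; rewrite mulrC pospow_div.
- by rewrite mulr1 mul1r addr0.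
- by apply: (sk_le_ge0 kD); lra.
- by apply: s_gt0; lra.
Qed.

(** The intermediate value theorem between a point near 0 and, by the symmetry
that exchanges [v] and [1 - v], a point near [D]. *)
Lemma side_mass_balance v : 0 < v -> v < 1 ->
  exists a, [/\ 0 < a, a < D & (1 - v) * side_mass k p a (D - a) = v * side_mass k p (D - a) a].
Proof.
move=> v0 v1.
have [b [b0 bD Lb]] : exists a, [/\ 0 < a, a <= D / 2 &
    (1 - (1 - v)) * side_mass k p a (D - a) <= (1 - v) * side_mass k p (D - a) a].
  have v0' : 0 < 1 - v by lra.
  have v1' : 1 - v < 1 by lra.
  exact: (side_mass_balance_left v0' v1').
have [a [a0 aD La]] := side_mass_balance_left v0 v1.
pose gl y := pospow p (s_ k (-1 * y + D) * 1).
pose gr y := pospow p (s_ k (1 * y + 0) * 1).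
have cgl : continuous gl by exact: continuous_sk_affine.
have cgr : continuous gr by exact: continuous_sk_affine.
(* [phi] is [psi] multiplied by the two powers in the denominators: it has the
   sign of [psi], and it involves [x] only through integrals and powers. *)
pose phi x := (1 - v) * itv_int gl 0 x * gr x - v * (itv_int gr 0 D - itv_int gr 0 x) * gl x.
pose psi x := (1 - v) * side_mass k p x (D - x) - v * side_mass k p (D - x) x.
have glE x : gl x = pospow p (s_ k (D - x)) by rewrite /gl mulr1 mulN1r addrC.
have grE x : gr x = pospow p (s_ k x) by rewrite /gr mulr1 mul1r addr0.
have phiE x : 0 < x -> x < D -> phi x = psi x * (gr x * gl x).
  move=> x0 xD.
  have lE : itv_int gl 0 x = side_mass k p x (D - x) * gl x.
    by rewrite glE; exact/esym/left_side_massE.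
  have rE : itv_int gr 0 D - itv_int gr 0 x = side_mass k p (D - x) x * gr x.
    rewrite grE right_side_massE//.
    by rewrite (itv_int_cat cgr (ltW x0) (ltW xD)) addrC addKr.
  rewrite /phi /psi rE lE.
  move: (side_mass _ _ _ _) (side_mass _ _ _ _) (gr x) (gl x) => L1 L2 g1 g2; ring.
have g_gt0 x : 0 < x -> x < D -> 0 < gr x * gl x.
  move=> x0 xD; rewrite glE grE.
  have xD0 : 0 < D - x by rewrite subr_gt0.
  have xDD : D - x < D by rewrite gtrBl.
  by apply: mulr_gt0; apply: pospow_gt0; exact: s_gt0.
have D2 : D / 2 < D by rewrite ltr_pdivrMr// ltr_pMr// ltr1n.
have aD' : a < D := le_lt_trans aD D2.
have bD' : D - b < D by rewrite gtrBl.
have bD0 : 0 < D - b by rewrite subr_gt0 (le_lt_trans bD D2).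
have ab : a <= D - b.
  by rewrite lerBrDr; apply: le_trans (lerD aD bD) _; rewrite -splitr.
have cphi : {within `[a, D - b], continuous phi}.
  have sub : `[a, D - b] `<=` `[0, D] by apply: subset_itv; rewrite bnd_simp ?ltW.
  have cl : {within `[a, D - b], continuous (itv_int gl 0)}.
    exact: continuous_subspaceW sub (continuous_itv_int (ltW D0) cgl).
  have cr : {within `[a, D - b], continuous (itv_int gr 0)}.
    exact: continuous_subspaceW sub (continuous_itv_int (ltW D0) cgr).
  have cgl' : {within `[a, D - b], continuous gl} := continuous_subspaceT cgl.
  have cgr' : {within `[a, D - b], continuous gr} := continuous_subspaceT cgr.
  move=> x; apply: cvgB.
    apply: cvgM; last exact: cgr'.
    by apply: cvgM; [exact: cvg_cst|exact: cl].
  apply: cvgM; last exact: cgl'.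
  by apply: cvgM; [exact: cvg_cst|apply: cvgB; [exact: cvg_cst|exact: cr]].
have phia : phi a <= 0.
  by rewrite (phiE a a0 aD') (pmulr_lle0 _ (g_gt0 a a0 aD')) /psi subr_le0.
have phib : 0 <= phi (D - b).
  rewrite (phiE _ bD0 bD') (pmulr_lge0 _ (g_gt0 _ bD0 bD')) /psi subr_ge0.
  by move: Lb; rewrite !subKr.
clearbody phi.
have phi0 : Num.min (phi a) (phi (D - b)) <= 0 <= Num.max (phi a) (phi (D - b)).
  by apply/andP; split; [rewrite ge_min phia|rewrite le_max phib orbT].
have [c] := IVT ab cphi phi0. rewrite in_itv => /andP[ac cb] phic.
have c0 : 0 < c by exact: lt_le_trans ac.
have cD : c < D by exact: le_lt_trans bD'.
exists c; split; [exact: c0|exact: cD|].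
move: phic; rewrite (phiE c c0 cD) => /eqP.
rewrite mulf_eq0 [X in _ || X]gt_eqF; last exact: g_gt0.
by rewrite orbF /psi subr_eq0 => /eqP.
Qed.

Let ler_cancel (F y L0 L v : R) : 0 < L0 -> 0 <= y -> L <= L0 ->
  F * L0 = v -> v <= y * L -> F <= y.
Proof.
move=> L00 y0 LL FL yL; rewrite -(ler_pM2r L00) FL.
by apply: le_trans yL _; rewrite ler_wpM2l.
Qed.

(** To the left of [a0] the bound on the left mass decides, to its right the
bound on the right mass. *)
Lemma side_mass_profile_min v F y a0 a : 0 < v -> v < 1 ->
  0 < a0 -> a0 < D -> F * side_mass k p a0 (D - a0) = v -> F * side_mass k p (D - a0) a0 = 1 - v ->
  0 < a -> a < D -> v <= y * side_mass k p a (D - a) -> 1 - v <= y * side_mass k p (D - a) a ->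
  F <= y.
Proof.
move=> v0 v1 a00 a0D FL FR a1 aD yL yR.
have L0 := side_mass_left_gt0 a1 aD.
have R0 := side_mass_right_gt0 a1 aD.
have y0 : 0 <= y.
  by rewrite -(pmulr_lge0 _ L0); exact: le_trans (ltW v0) yL.
have [aa0|/ltW aa0] := leP a a0.
  exact: ler_cancel (side_mass_left_gt0 a00 a0D) y0 (le_side_mass_left a1 aa0 a0D) FL yL.
exact: ler_cancel (side_mass_right_gt0 a00 a0D) y0 (le_side_mass_right a00 aa0 aD) FR yR.
Qed.

End fixed_diameter.
End side_mass.

(** * The half-line profile *)


Section profile.
Context {R : realType}.
Implicit Types (a b k p l D v w y : R) (f g : R -> R).

(** The value 0 outside of ]0, 1[ is the content of the half-lines of mass 0
and 1. *)
Definition half_line_profile (K N D w : R) : R :=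
  if 0 < w < 1 then f_ K N D (a_ K N D w) else 0.

Lemma half_line_profile_out K N D w : ~~ (0 < w < 1) -> half_line_profile K N D w = 0.
Proof. by move=> /negbTE nw; rewrite /half_line_profile nw. Qed.

Lemma half_line_profileE K N D w : 0 < w < 1 ->
  half_line_profile K N D w = f_ K N D (a_ K N D w).
Proof. by rewrite /half_line_profile => ->. Qed.

Lemma in_model_range_diameter (K N D : R) : 1 < N ->
  (0 < K -> D <= pi * Num.sqrt ((N - 1) / K)) -> in_model_range (kappa K N) D.
Proof.
move=> N1 KD k0.
have K0 : 0 < K by rewrite /kappa pmulr_lgt0 ?invr_gt0 ?subr_gt0// in k0.
apply: le_trans (KD K0) _; rewrite -sqrtrV; last exact: ltW.
by rewrite /kappa invf_div.
Qed.

Variables (K N D : R).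
Hypotheses (N1 : 1 < N) (D0 : 0 < D) (kD : in_model_range (kappa K N) D).
Let k := kappa K N.
Let p := N - 1.
Let p0 : 0 < p. Proof. by rewrite subr_gt0. Qed.
Let L a := side_mass k p a (D - a).
Let Rr a := side_mass k p (D - a) a.
Let F := half_line_profile K N D.

Let L_gt0 a : 0 < a -> a < D -> 0 < L a.
Proof. exact: side_mass_left_gt0. Qed.

Let R_gt0 a : 0 < a -> a < D -> 0 < Rr a.
Proof. exact: side_mass_right_gt0. Qed.

Lemma left_powerE a y : 0 < a -> a < D -> 0 <= y -> y <= a ->
  (s_ k (D - y) / s_ k (D - a)) `^ (N - 1) = pospow p (s_ k (D - y) / s_ k (D - a)).
Proof.
move=> a0 aD y0 ya; rewrite pospowE// divr_ge0//.
  by apply: (sk_le_ge0 kD); lra.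
by apply/ltW/(sk_lt_gt0 kD); lra.
Qed.

Lemma right_powerE a y : 0 < a -> a < D -> a <= y -> y <= D ->
  (s_ k y / s_ k a) `^ (N - 1) = pospow p (s_ k y / s_ k a).
Proof.
move=> a0 aD ay yD; rewrite pospowE// divr_ge0//.
  by apply: (sk_le_ge0 kD); lra.
by apply/ltW/(sk_lt_gt0 kD); lra.
Qed.

Let gl a := (fun y => pospow p (s_ k (D - y) / s_ k (D - a))).

Lemma continuous_left_power a : continuous (gl a).
Proof.
rewrite (_ : gl a = (fun x => pospow p (s_ k (-1 * x + D) / s_ k (D - a)))).
  exact: continuous_sk_affine.
by apply/funext => x; rewrite mulN1r addrC.
Qed.

Let left_integralE a : 0 < a -> a < D ->
  \int[lebesgue_measure]_(y in `[0, a]) (s_ k (D - y) / s_ k (D - a)) `^ (N - 1) = L a.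
Proof.
move=> a0 aD; transitivity (itv_int (gl a) 0 a).
  apply: eq_Rintegral => y; rewrite inE => /itvP ya.
  by apply: left_powerE => //; rewrite ya.
exact: (itv_int_left_side_mass k D p0 (ltW a0)).
Qed.

Let right_integralE a : 0 < a -> a < D ->
  \int[lebesgue_measure]_(y in `[a, D]) (s_ k y / s_ k a) `^ (N - 1) = Rr a.
Proof.
move=> a0 aD; transitivity (itv_int (fun y => pospow p (s_ k y / s_ k a)) a D).
  apply: eq_Rintegral => y; rewrite inE => /itvP ya.
  by apply: right_powerE => //; rewrite ya.
exact: (itv_int_right_side_mass k p0 (ltW aD)).
Qed.

Lemma f_side_massE a : 0 < a -> a < D -> f_ K N D a = (L a + Rr a)^-1.
Proof. by move=> a0 aD; rewrite /f_ (left_integralE a0 aD) (right_integralE a0 aD). Qed.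

Lemma integral_h_left a : 0 < a -> a < D ->
  \int[lebesgue_measure]_(x in `[0, a]) h_ K N D a x = f_ K N D a * L a.
Proof.
move=> a0 aD.
transitivity (itv_int (fun y => f_ K N D a * gl a y) 0 a).
  apply: eq_Rintegral => y; rewrite inE => /itvP ya.
  by rewrite /h_ ya left_powerE// ya.
transitivity (f_ K N D a * itv_int (gl a) 0 a).
  exact: (itv_intZ _ _ _ (@continuous_left_power a)).
exact: (congr1 ( *%R (f_ K N D a)) (itv_int_left_side_mass k D p0 (ltW a0))).
Qed.

Lemma a_spec v : 0 < v -> v < 1 -> let a := a_ K N D v in
  [/\ 0 < a, a < D, f_ K N D a * L a = v & f_ K N D a * Rr a = 1 - v].
Proof.
move=> v0 v1 /=.
have f_sum a : 0 < a -> a < D -> f_ K N D a * L a + f_ K N D a * Rr a = 1.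
  move=> a0 aD; rewrite -mulrDr (f_side_massE a0 aD) mulVf// gt_eqF//.
  exact: (addr_gt0 (L_gt0 a0 aD) (R_gt0 a0 aD)).
have : [set a | 0 < a < D /\
    \int[lebesgue_measure]_(x in `[0, a]) h_ K N D a x = v] (a_ K N D v).
  apply: getPex.
  have [a [a0 aD bal]] := side_mass_balance p0 D0 kD v0 v1.
  exists a; apply: conj.
    by apply/andP; split.
  apply: (etrans (integral_h_left a0 aD)).
  have e := f_sum a a0 aD.
  move: bal e; rewrite -/(L a) -/(Rr a).
  generalize (L a) (Rr a) (f_ K N D a) => l r f bal e.
  have e2 : (1 - v) * (f * l) = v * (f * r) by rewrite mulrCA bal mulrCA.
  by rewrite -[LHS]mul1r -[1 in LHS](subrK v) mulrDl e2 -mulrDr [f * r + _]addrC e mulr1.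
case=> /andP[a0 aD]; rewrite (integral_h_left a0 aD) => e.
split; [exact: a0|exact: aD|exact: e|].
have aux (x y z : R) : x + y = 1 -> x = z -> y = 1 - z.
  by move=> <- ->; rewrite [z + y]addrC addrK.
exact: (aux _ _ _ (f_sum _ a0 aD) e).
Qed.

Lemma profile_spec v : 0 < v -> v < 1 ->
  exists a, [/\ 0 < a, a < D, F v * L a = v & F v * Rr a = 1 - v].
Proof.
move=> v0 v1; exists (a_ K N D v); have := a_spec v0 v1.
by rewrite /F /half_line_profile v0 v1.
Qed.

(** The profile as a minimum: its symmetry and its monotonicity properties follow
by exhibiting a competitor [y] together with a base point [a]. *)
Lemma profile_min v y a : 0 < v -> v < 1 -> 0 < a -> a < D ->
  v <= y * L a -> 1 - v <= y * Rr a -> F v <= y.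
Proof.
move=> v0 v1 a0 aD yL yR.
have [a' [a'0 a'D FL FR]] := profile_spec v0 v1.
exact: (side_mass_profile_min p0 kD v0 v1 a'0 a'D FL FR a0 aD yL yR).
Qed.

Lemma profile_ge0 v : 0 <= F v.
Proof.
have [/andP[v0 v1]|nv] := boolP (0 < v < 1); last by rewrite /F /half_line_profile (negbTE nv).
have [a [a0 aD FL FR]] := profile_spec v0 v1.
by rewrite -(pmulr_lge0 _ (L_gt0 a0 aD)) FL ltW.
Qed.

(** Competitor: the reflected base point [D - a]. *)
Let profile_sym_le v : 0 < v -> v < 1 -> F (1 - v) <= F v.
Proof.
move=> v0 v1.
have [a [a0 aD FL FR]] := profile_spec v0 v1.
have v0' : 0 < 1 - v by lra.
have v1' : 1 - v < 1 by lra.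
have b0 : 0 < D - a by rewrite subr_gt0.
have bD : D - a < D by rewrite gtrBl.
apply: (profile_min v0' v1' b0 bD).
  by rewrite /L subKr -FR.
by rewrite /Rr !subKr -[leLHS]FL.
Qed.

Lemma profile_sym v : F (1 - v) = F v.
Proof.
have [/andP[v0 v1]|nv] := boolP (0 < v < 1); last first.
  rewrite /F /half_line_profile (negbTE nv) ifF//.
  by apply/negbTE; apply: contra nv => /andP[h1 h2]; apply/andP; split; lra.
apply: le_anti; apply/andP; split; first exact: profile_sym_le.
have v0' : 0 < 1 - v by lra.
have v1' : 1 - v < 1 by lra.
have e : 1 - (1 - v) = v by rewrite subKr.
by move: (profile_sym_le v0' v1'); rewrite e.
Qed.

Lemma profile0 : F 0 = 0.
Proof. by rewrite /F /half_line_profile ltxx. Qed.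

Lemma profile1 : F 1 = 0.
Proof. by rewrite /F /half_line_profile ltxx andbF. Qed.

Opaque half_line_profile.

(** Competitor: [F w1 * w2 / w1] at the base point of [w1].  It turns the
condition on the left mass into an equality, and it satisfies the condition on
the right mass because [w2 / w1] is at least 1. *)
Lemma profile_ratio_anti w1 w2 : 0 <= w1 -> w1 <= w2 -> w2 <= 1 ->
  F w2 * w1 <= F w1 * w2.
Proof.
move=> w10 w12 w21.
have [w1z|w1n] := eqVneq w1 0; first by rewrite w1z profile0 mulr0 mul0r.
have [w2o|w2n] := eqVneq w2 1.
  by rewrite w2o profile1 mul0r mulr1; exact: profile_ge0.
have {w1n}w10 : 0 < w1 by rewrite lt_neqAle eq_sym w1n.
have {w2n}w21 : w2 < 1 by rewrite lt_neqAle w2n.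
have w20 : 0 < w2 by exact: lt_le_trans w12.
have w11 : w1 < 1 by exact: le_lt_trans w21.
rewrite -(ler_pdivlMr _ _ w10).
have [a [a0 aD FL FR]] := profile_spec w10 w11.
have e1 x : F w1 * w2 / w1 * x = w2 / w1 * (F w1 * x).
  by generalize (F w1) => z; ring.
have r1 : 1 <= w2 / w1 by rewrite ler_pdivlMr// mul1r.
apply: (profile_min w20 w21 a0 aD).
  by rewrite e1 FL divfK// gt_eqF.
rewrite e1 FR; apply: (@le_trans _ _ (1 - w1)); first by rewrite lerB.
by rewrite ler_peMl// subr_ge0 ltW.
Qed.

End profile.

(** Dilation by [D / D'] increases both side masses, so the value of the profile
on the short segment is a competitor on the long one. *)
Lemma profile_diam_anti {R : realType} (K N D D' v : R) : 1 < N -> K <= 0 ->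
  0 < D' -> D' <= D -> 0 < v -> v < 1 ->
  half_line_profile K N D v <= half_line_profile K N D' v.
Proof.
move=> N1 K0 D'0 DD v0 v1.
have p0 : 0 < N - 1 by rewrite subr_gt0.
have k0 : kappa K N <= 0 by rewrite /kappa pmulr_lle0// invr_gt0.
have kD E : in_model_range (kappa K N) E by move=> k0'; move: (lt_le_trans k0' k0); rewrite ltxx.
have D0 : 0 < D by exact: lt_le_trans DD.
have [a [a0 aD FL FR]] := profile_spec N1 D'0 (kD D') v0 v1.
have F0 := profile_ge0 N1 D'0 (kD D') v.
pose l := D / D'.
have l1 : 1 <= l by rewrite ler_pdivlMr// mul1r.
have l0 : 0 < l by exact: lt_le_trans l1.
have lD : l * D' = D by rewrite /l divfK// gt_eqF.
have la0 : 0 < l * a by exact: mulr_gt0.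
have laD : l * a < D by rewrite -lD ltr_pM2l.
have b0 : 0 < D' - a by rewrite subr_gt0.
have E : D - l * a = l * (D' - a) by rewrite mulrBr lD.
apply: (profile_min N1 D0 (kD D) v0 v1 la0 laD).
  rewrite E; apply: le_trans (ler_wpM2l F0 (le_side_mass_scale p0 k0 l1 a0 b0)).
  by rewrite [leRHS]FL.
rewrite E; apply: le_trans (ler_wpM2l F0 (le_side_mass_scale p0 k0 l1 b0 a0)).
by rewrite [leRHS]FR.
Qed.

(** * From half-lines to Borel sets *)

Section profile_to_borel.
Context {R : realType}.
Implicit Types (u w p q x d v V e : R).
(** The properties of a half-line profile on which the passage to Borel sets
rests; [F_ratio] is the monotonicity of [F w / w], without division. *)
Variable F : R -> R.
Hypothesis F_ge0 : forall w, 0 <= F w.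
Hypothesis F0 : F 0 = 0.
Hypothesis F_sym : forall w, F (1 - w) = F w.
Hypothesis F_ratio : forall w1 w2, 0 <= w1 -> w1 <= w2 -> w2 <= 1 ->
  F w2 * w1 <= F w1 * w2.

Lemma ratio_compl w1 w2 : 0 <= w1 -> w1 <= w2 -> w2 <= 1 ->
  F w1 * (1 - w2) <= F w2 * (1 - w1).
Proof.
move=> w10 w12 w21; have := @F_ratio (1 - w2) (1 - w1).
by rewrite !F_sym; apply; lra.
Qed.

Lemma subadditive_of_ratio u w : 0 <= u -> 0 <= w -> u + w <= 1 -> F (u + w) <= F u + F w.
Proof.
move=> u0 w0 uw1.
have [uwz|uwn] := eqVneq (u + w) 0; first by rewrite uwz F0 addr_ge0.
have uw0 : 0 < u + w by rewrite lt_neqAle eq_sym uwn addr_ge0.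
rewrite -(ler_pM2r uw0) mulrDr mulrDl; apply: lerD; apply: F_ratio; lra.
Qed.

(** The complement of an interval is a disjoint union of two half-lines, of
masses [1 - u] and [w]. *)
Lemma subadditive_sub u w : 0 <= w -> w <= u -> u <= 1 -> F (u - w) <= F u + F w.
Proof.
move=> w0 wu u1; rewrite -F_sym -[F u]F_sym (_ : 1 - (u - w) = (1 - u) + w); last by ring.
by apply: subadditive_of_ratio; lra.
Qed.

(** A lower bound for [F] on a short interval of masses by nearly one of its own
end values, with a loss that depends only on the length: the end [p] serves if
[1 - p] is at least [1 / 2], and the end [p'] if [p] is at least [1 / 2]. *)
Lemma almost_minimizer_itv p p' d : 0 <= p -> p <= p' -> p' <= 1 -> p' - p <= d ->
  exists2 q, p <= q <= p' & forall x, p <= x -> x <= p' -> (1 - 2 * d) * F q <= F x.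
Proof.
move=> p0 pp p1 ppd; have [ph|hp] := leP p (1 / 2).
  exists p; first by rewrite lexx.
  move=> x px xp.
  have s := ratio_compl p0 px (le_trans xp p1).
  have e : 0 < 1 - p by lra.
  rewrite -(ler_pM2r e); apply: le_trans s.
  rewrite mulrAC [F p * _]mulrC; apply: (ler_wpM2r (F_ge0 _)); nra.
exists p'; first by rewrite lexx andbT.
move=> x px xp.
have x0 : 0 <= x by lra.
have s := F_ratio x0 xp p1.
have e : 0 < p' by lra.
rewrite -(ler_pM2r e); apply: le_trans s.
rewrite mulrAC [F p' * _]mulrC; apply: (ler_wpM2r (F_ge0 _)); nra.
Qed.

(** [F w / (1 - w)] is nondecreasing, so an increase of the mass by [d] lowers
[F] at most by the factor [1 - d / (1 - v)]. *)
Lemma increase_bound v q d V : 0 <= v -> v <= V -> V < 1 -> v <= q -> q <= v + d -> q <= 1 ->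
  0 <= d -> (1 - d / (1 - V)) * F v <= F q.
Proof.
move=> v0 vV V1 vq qd q1 d0.
have s := ratio_compl v0 vq q1.
have e : 0 < 1 - v by lra.
rewrite -(ler_pM2r e); apply: le_trans s.
rewrite mulrAC [F v * _]mulrC; apply: (ler_wpM2r (F_ge0 _)).
have V0 : 0 < 1 - V by lra.
apply: (@le_trans _ _ ((1 - d / (1 - v)) * (1 - v))); last first.
  rewrite mulrBl divfK ?gt_eqF//; lra.
rewrite ler_pM2r// lerB// ler_wpM2l// lef_pV2 ?posrE//; lra.
Qed.

Variable mu : probability (measurableTypeR R) R.
Implicit Types A B : set R.
Let m A : R := fine (mu A).
Let H x : R := m `]-oo, x].
Hypothesis mu_set1 : forall x, mu [set x] = 0%E.
(** The isoperimetric inequality for half-lines, integrated over an interval. *)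
Hypothesis density_ge : forall a b c, a < b ->
  (forall x, a < x -> x < b -> c <= F (H x)) -> c * (b - a) <= m `]a, b[.

Let mE A : measurable A -> mu A = (m A)%:E.
Proof. by move=> mA; rewrite /m fineK// fin_num_measure. Qed.

Let m_ge0 A : 0 <= m A.
Proof. exact: fine_ge0. Qed.

Let m_le A B : measurable A -> measurable B -> A `<=` B -> m A <= m B.
Proof.
by move=> mA mB AB; rewrite -lee_fin -!mE// le_measure// inE.
Qed.

Let m_le1 A : measurable A -> m A <= 1.
Proof. by move=> mA; rewrite -lee_fin -mE// probability_le1. Qed.

Let mU A B : measurable A -> measurable B -> A `&` B = set0 -> m (A `|` B) = m A + m B.
Proof.
by move=> mA mB AB; apply: EFin_inj; rewrite EFinD -!mE ?measureU//; exact: measurableU.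
Qed.

Let H_ge0 x : 0 <= H x. Proof. exact: m_ge0. Qed.

Let H_le1 x : H x <= 1. Proof. exact: m_le1. Qed.

Let H_le x y : x <= y -> H x <= H y.
Proof.
by move=> xy; apply: m_le => //; apply: subset_itv; rewrite bnd_simp.
Qed.

Let m_set1 x : m [set x] = 0.
Proof. by rewrite /m mu_set1. Qed.

Let m_itv_oc x y : x <= y -> m `]x, y] = H y - H x.
Proof.
move=> xy; apply/eqP; rewrite eq_sym subr_eq addrC -mU//; last first.
  rewrite -subset0 => z [/=]; rewrite !in_itv/= => zx /andP[xz _]; move: zx xz; lra.
apply/eqP; congr m; apply/seteqP; split => z /=; rewrite !in_itv/=.
  by move=> zy; have [zx|xz] := leP z x; [left|right; apply/andP].
by case=> [zx|/andP[]//]; exact: le_trans xy.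
Qed.

Let m_itv_oo x y : x < y -> m `]x, y[ = H y - H x.
Proof.
move=> xy; rewrite -m_itv_oc ?ltW// -(@setUitv1 _ _ _ y true) ?bnd_simp// mU// ?m_set1 ?addr0//.
by rewrite -subset0 => z [/= + zy]; rewrite in_itv/= zy ltxx andbF.
Qed.

Let m_itv_cc x y : x <= y -> m `[x, y] = H y - H x.
Proof.
move=> xy; rewrite -m_itv_oc// -(@setU1itv _ _ _ x false) ?bnd_simp// mU// ?m_set1 ?add0r//.
by rewrite -subset0 => z [/= ->]; rewrite in_itv/= ltxx.
Qed.

Definition thickening (A : set R) e : set R := [set x | exists2 a, A a & `|x - a| < e].

Lemma thickening_open A e : open (thickening A e).
Proof.
rewrite (_ : thickening A e = \bigcup_(a in A) ball a e).
  by apply: bigcup_open => a _; exact: (@ball_open R R a e).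
apply/seteqP; split => [x [a Aa xa]|x [a Aa xa]].
  by exists a => //; rewrite /ball/= distrC.
by exists a => //; rewrite distrC.
Qed.

Lemma sub_thickening A e : 0 < e -> A `<=` thickening A e.
Proof. by move=> e0 x Ax; exists x => //; rewrite subrr normr0. Qed.

Let m_thickening A e : measurable (thickening A e).
Proof. exact: (open_measurable (@thickening_open A e)). Qed.

Section thickening_bound.
Variables (e d V : R).
Hypotheses (e0 : 0 < e) (d0 : 0 <= d) (d1 : 2 * d <= 1) (V1 : V < 1) (dV : d <= 1 - V).
(** The loss when thickening a set of mass at most [V] adds at most [d].  It does
not depend on the set, hence it survives the splitting of a set at a gap. *)
Let theta := (1 - 2 * d) * (1 - d / (1 - V)).

Let theta_ge0 : 0 <= theta.
Proof.
move: d1 V1 dV => d1' V1' dV'.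
have V0 : 0 < 1 - V by lra.
apply: mulr_ge0; first by lra.
by rewrite subr_ge0 ler_pdivrMr// mul1r.
Qed.

(** The added intervals ]a - e, a[ and ]b, b + e[ have masses at least nearly
[e * F q] and [e * F p], for masses [q] and [p] of half-lines that end in them;
[F p + F q] bounds [F (p - q)], and [p - q] exceeds the mass of [A] by at most
[d]. *)
Lemma thickening_bound_interval A B a b : measurable A -> measurable B ->
  a <= b -> A `<=` `[a, b] -> A `<=` B -> `]a - e, b + e[ `<=` B ->
  m A <= V -> m B - m A <= d -> e * theta * F (m A) <= m B - m A.
Proof.
move=> mA mB ab Aab AB abB AV BAd.
move: (e0) (d0) (d1) (V1) (dV) => e0' d0' d1' V1' dV'.
have ae : a - e < a by lra.
have be : b < b + e by lra.
have abe : a - e < b + e by lra.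
have eq1 : m `]a - e, a[ + m `]b, b + e[ + m A <= m B.
  rewrite -!mU//.
  - apply: m_le => //; first by do 2 apply: measurableU => //.
    move=> x [[|]|/AB//]; rewrite /= in_itv/= => /andP[h1 h2]; apply: abB;
      rewrite /= in_itv/=; apply/andP; split; lra.
  - exact: measurableU.
  - rewrite -subset0 => x [+ /Aab]; rewrite /= !in_itv/= => + /andP[h1 h2].
    by case=> /andP[h3 h4]; lra.
  - rewrite -subset0 => x []; rewrite /= !in_itv/= => /andP[h1 h2] /andP[h3 h4]; lra.
have mab : m A <= H b - H a by rewrite -m_itv_cc//; apply: m_le.
have mabe : H (b + e) - H (a - e) <= m B by rewrite -m_itv_oo//; apply: m_le.
rewrite m_itv_oo// m_itv_oo// in eq1.
have mA0 := m_ge0 A.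
have [Hae Hab Hbe] : [/\ H (a - e) <= H a, H a <= H b & H b <= H (b + e)].
  by split; apply: H_le => //; exact: ltW.
have H1 := H_le1 (b + e); have H0 := H_ge0 (a - e).
have [p /andP[p1 p2] Fp] := @almost_minimizer_itv (H b) (H (b + e)) d (H_ge0 _) Hbe H1 ltac:(lra).
have [q /andP[q1 q2] Fq] := @almost_minimizer_itv (H (a - e)) (H a) d H0 Hae (H_le1 _) ltac:(lra).
have Fpq : (1 - d / (1 - V)) * F (m A) <= F (p - q) by apply: increase_bound; lra.
have Fpq2 : F (p - q) <= F p + F q by apply: subadditive_sub; lra.
have I1 : (1 - 2 * d) * F p * e <= H (b + e) - H b.
  have -> : e = b + e - b by ring.
  rewrite -m_itv_oo//; last lra.
  rewrite (_ : b + (b + e - b) = b + e); last by ring.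
  by apply: density_ge => // x bx xbe; apply: Fp; apply: H_le; exact: ltW.
have I2 : (1 - 2 * d) * F q * e <= H a - H (a - e).
  have {1}-> : e = a - (a - e) by ring.
  rewrite -m_itv_oo//.
  by apply: density_ge => // x bx xbe; apply: Fq; apply: H_le; exact: ltW.
apply: (@le_trans _ _ (e * ((1 - 2 * d) * (F p + F q)))); last by lra.
rewrite /theta -!mulrA; apply: ler_wpM2l; first exact: ltW.
apply: ler_wpM2l; first by lra.
exact: le_trans Fpq2.
Qed.

(** Induction on the length of a segment that contains [A], in units of
[2 * e]. *)
Lemma thickening_bound n A c : measurable A -> A `<=` `[c, c + n%:R * (2 * e)[ ->
  m A <= V -> m (thickening A e) - m A <= d ->
  e * theta * F (m A) <= m (thickening A e) - m A.
Proof.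
move: (e0) (d0) (d1) (V1) (dV) => e0' d0' d1' V1' dV'.
have bound0 B : B = set0 -> e * theta * F (m B) <= m (thickening B e) - m B.
  move=> ->; rewrite {1 3}/m measure0/= F0 mulr0 subr0; exact: m_ge0.
elim: n A c => [|n IH] A c mA Ac AV Ad.
  apply: bound0; rewrite -subset0 => x /Ac; rewrite /= in_itv/= mul0r addr0; lra.
have [/bound0//|/set0P[x0 Ax0]] := eqVneq A set0.
have [[p [gap [y Ay yp] [z Az pz]]]|nogap] := pselect (exists p, 
  [/\ forall x, A x -> x <= p \/ p + 2 * e <= x,
      exists2 y, A y & y <= p & exists2 z, A z & p + 2 * e <= z]).
  (* A gap of length [2 * e]: both parts of [A] are shorter by one unit, and
     their thickenings are disjoint. *)
  pose A1 := A `&` `]-oo, p].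
  pose A2 := A `&` `[p + 2 * e, +oo[.
  have mA1 : measurable A1 by exact: measurableI.
  have mA2 : measurable A2 by exact: measurableI.
  have AE : A = A1 `|` A2.
    apply/seteqP; split => [x Ax|x [[]//|[]//]].
    by case: (gap x Ax) => h; [left|right]; split=> //=; rewrite in_itv/= ?andbT.
  have A12 : A1 `&` A2 = set0.
    rewrite -subset0 => x [[_ +] [_]]; rewrite /= !in_itv/= andbT; have := e0; lra.
  have TE : thickening A e = thickening A1 e `|` thickening A2 e.
    apply/seteqP; split => [x [a]|x [|] [a Aa xa]].
    - by rewrite AE => -[h|h] xa; [left|right]; exists a.
    - by exists a => //; rewrite AE; left.
    - by exists a => //; rewrite AE; right.
  have T12 : thickening A1 e `&` thickening A2 e = set0.
    rewrite -subset0 => x [[a [_ +] +] [b [_]]] /=; rewrite !in_itv/= andbT !ltr_norml.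
    by rewrite in_itv/= => ap /andP[h1 h2] pb /andP[h3 h4]; lra.
  have m1 : m A1 <= m (thickening A1 e) by apply: m_le => //; exact: sub_thickening.
  have m2 : m A2 <= m (thickening A2 e) by apply: m_le => //; exact: sub_thickening.
  have mAE : m A = m A1 + m A2 by rewrite {1}AE mU.
  have mTE : m (thickening A e) = m (thickening A1 e) + m (thickening A2 e) by rewrite TE mU.
  have p1 := m_ge0 A1; have p2 := m_ge0 A2.
  have := Ac _ Ay; have := Ac _ Az; rewrite /= !in_itv/= -natr1 mulrDl mul1r.
  move=> /andP[cz zn] /andP[cy yn].
  have B1 : e * theta * F (m A1) <= m (thickening A1 e) - m A1.
    apply: (IH A1 c) => //; try lra.
    move=> x [/Ac]; rewrite /= !in_itv/= => /andP[cx _] xp; rewrite cx/=; lra.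
  have B2 : e * theta * F (m A2) <= m (thickening A2 e) - m A2.
    apply: (IH A2 (c + 2 * e)) => //; try lra.
    move=> x [/Ac]; rewrite /= !in_itv/= andbT -natr1 mulrDl mul1r => /andP[cx xn] px.
    apply/andP; split; lra.
  have sub : F (m A) <= F (m A1) + F (m A2).
    by rewrite mAE; apply: subadditive_of_ratio => //; rewrite -mAE; exact: m_le1.
  apply: (@le_trans _ _ (e * theta * (F (m A1) + F (m A2)))).
    by apply: ler_wpM2l => //; rewrite mulr_ge0// ltW.
  by rewrite mulrDr mTE mAE; lra.
(* No such gap: the thickening fills the whole interval ]inf A - e, sup A + e[. *)
have hlb : has_lbound A.
  by exists c => x /Ac; rewrite /= in_itv/= => /andP[].
have hub : has_ubound A.
  by exists (c + n.+1%:R * (2 * e)) => x /Ac; rewrite /= in_itv/= => /andP[_ /ltW].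
have infA x : A x -> inf A <= x by move=> Ax; exact: ge_inf.
have supA x : A x -> x <= sup A by move=> Ax; exact: ub_le_sup.
apply: (@thickening_bound_interval A (thickening A e) (inf A) (sup A)) => //.
- exact: le_trans (infA _ Ax0) (supA _ Ax0).
- by move=> x Ax; rewrite /= in_itv/= infA// supA.
- exact: sub_thickening.
- move=> x; rewrite /= in_itv/= => /andP[ix xs].
  have [//|nx] := pselect (thickening A e x).
  exfalso; apply: nogap; exists (x - e); split.
  + move=> y Ay; have [yx|xy] := leP y (x - e); first by left.
    right; have [//|yx] := leP (x - e + 2 * e) y; exfalso; apply: nx.
    by exists y => //; rewrite ltr_norml; apply/andP; split; lra.
  + have [y Ay yx] : exists2 y, A y & y < x + e.
      by apply: inf_lt; [exists x0|lra].
    exists y => //; have [//|xy] := leP y (x - e); exfalso; apply: nx.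
    by exists y => //; rewrite ltr_norml; apply/andP; split; lra.
  + have [y Ay yx] : exists2 y, A y & x - e < y.
      by apply: sup_gt; [exists x0|lra].
    exists y => //; have [//|xy] := leP (x - e + 2 * e) y; exfalso; apply: nx.
    by exists y => //; rewrite ltr_norml; apply/andP; split; lra.
Qed.

End thickening_bound.

End profile_to_borel.

(** * The outer Minkowski content *)

Section content.
Context {R : realType}.
Variable mu : probability (measurableTypeR R) R.
Implicit Types (A : set R) (c e r : R).
Let m A : R := fine (mu A).

Lemma enlargementE A e : enlargement A e = thickening A e.
Proof.
apply/seteqP; split => x; rewrite /enlargement /thickening /=.
  move=> /ereal_inf_lt[_ [a Aa <-]] /edist_lt_ball xa.
  by exists a.
case=> a Aa xa; pose r := (`|x - a| + e) / 2.
have [r0 ar re] : [/\ 0 < r, `|x - a| < r & r < e].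
  by have := normr_ge0 (x - a); rewrite /r; split; lra.
apply: (@le_lt_trans _ _ (edist (x, a))).
  by apply: ereal_inf_lbound; exists a.
apply: (@le_lt_trans _ _ r%:E); last by rewrite lte_fin.
exact: (@edist_fin R R r (x, a) r0 ar).
Qed.

Lemma minkowski_quotientE A e : measurable (A : set (measurableTypeR R)) -> 0 < e ->
  ((mu (enlargement A e) - mu A) / e%:E)%E = ((m (thickening A e) - m A) / e)%:E.
Proof.
move=> mA e0; have mT : measurable (thickening A e : set (measurableTypeR R)).
  exact: (open_measurable (@thickening_open R A e)).
rewrite enlargementE inver gt_eqF// EFinM EFinB /m !fineK ?fin_num_measure//.
Qed.

Lemma minkowski_content_ge A c : measurable (A : set (measurableTypeR R)) ->
  (forall eta, 0 < eta -> exists2 r, 0 < r & forall e, 0 < e -> e < r ->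
     c - eta <= (m (thickening A e) - m A) / e) ->
  (c%:E <= minkowski_content mu A)%E.
Proof.
move=> mA H; apply/lee_addgt0Pr => eta /H[r r0 Hr].
rewrite -leeBlDr// -EFinB /minkowski_content limf_einfE.
apply: ereal_sup_ge.
exists (ereal_inf ((fun e : R => ((mu (enlargement A e) - mu A) / e%:E)%E) @`
   [set e | 0 < e < r])).
  exists [set e | 0 < e < r] => //.
  near=> e; apply/andP; split; near: e; first exact: nbhs_right_gt.
  exact: nbhs_right_lt.
apply: le_ereal_inf_tmp => _ [e /andP[e0 er] <-].
by rewrite minkowski_quotientE// lee_fin Hr.
Unshelve. all: end_near. Qed.

Lemma minkowski_content_le A c : measurable (A : set (measurableTypeR R)) ->
  (forall eta r, 0 < eta -> 0 < r -> exists e, [/\ 0 < e, e < r &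
     (m (thickening A e) - m A) / e <= c + eta]) ->
  (minkowski_content mu A <= c%:E)%E.
Proof.
move=> mA H; apply/lee_addgt0Pr => eta eta0.
rewrite /minkowski_content limf_einfE; apply: ge_ereal_sup => _ [V [r /= r0 Vr] <-].
have [e [e0 er He]] := H _ _ eta0 r0.
apply: (@le_trans _ _ ((m (thickening A e) - m A) / e)%:E); last by rewrite -EFinD lee_fin.
apply: ereal_inf_lbound; exists e; last exact: minkowski_quotientE.
by apply: Vr => //=; rewrite sub0r normrN gtr0_norm.
Qed.

(** If the thickening adds at most [d], then [thickening_bound] applies with a
loss that is small with [d]; if it adds more than [d], the quotient is already
large, since [e] is small compared with [d]. *)
Lemma minkowski_content_lower_bound (F : R -> R) A (v D : R) :
  (forall w, 0 <= F w) -> F 0 = 0 -> (forall w, F (1 - w) = F w) ->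
  (forall w1 w2, 0 <= w1 -> w1 <= w2 -> w2 <= 1 -> F w2 * w1 <= F w1 * w2) ->
  (forall x, mu [set x] = 0%E) ->
  (forall a b c, a < b ->
    (forall x, a < x -> x < b -> c <= F (m `]-oo, x])) -> c * (b - a) <= m `]a, b[) ->
  measurable (A : set (measurableTypeR R)) -> A `<=` `[0, D] -> m A = v -> v < 1 ->
  ((F v)%:E <= minkowski_content mu A)%E.
Proof.
move=> F_ge0 F0 F_sym F_ratio mu1 dens mA AD Av v1.
have v0 : 0 <= v by rewrite -Av fine_ge0.
apply: minkowski_content_ge => // eta eta0.
have Fv := F_ge0 v.
pose C := 2 + (1 - v)^-1.
have v1' : 0 < 1 - v by lra.
have iv : 0 < (1 - v)^-1 by rewrite invr_gt0.
have C0 : 0 < C * (F v + 1) by rewrite mulr_gt0// /C; lra.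
(* The loss in [thickening_bound] is at most [C * d], and [d] is chosen such
   that [C * d * F v <= eta]. *)
pose d := Num.min (2^-1) (Num.min (1 - v) (eta / (C * (F v + 1)))).
have d0 : 0 < d by rewrite !lt_min v1' invr_gt0 ltr0n divr_gt0.
have d1 : d <= 2^-1 by rewrite ge_min lexx.
have d2 : d <= 1 - v by rewrite !ge_min lexx orbT.
have d3 : d * (C * (F v + 1)) <= eta by rewrite -ler_pdivlMr// !ge_min lexx !orbT.
exists (d / (F v + 1)); first by rewrite divr_gt0//; lra.
move=> e e0 er; rewrite ler_pdivlMr//.
have [Jd|dJ] := leP (m (thickening A e) - m A) d; last first.
  rewrite ltr_pdivlMr in er; last lra.
  apply: le_trans (ltW dJ); apply: le_trans (ltW er).
  by rewrite mulrC ler_pM2l//; lra.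
pose n := Num.bound (D / (2 * e)).
have An : A `<=` `[0, 0 + n%:R * (2 * e)[.
  move=> x Ax; have := AD x Ax; rewrite /= !in_itv/= => /andP[x0 xD].
  rewrite x0 add0r -ltr_pdivrMr/=; last lra.
  apply: le_lt_trans (archi_boundP _); last by rewrite divr_ge0//; lra.
  by rewrite ler_pM2r// invr_gt0; lra.
have := @thickening_bound R F F_ge0 F0 F_sym F_ratio mu mu1 dens e d v e0 (ltW d0)
  ltac:(lra) v1 d2 n A 0 mA An.
rewrite -/(m A) -/(m _) Av => /(_ (lexx _)) H.
rewrite Av in Jd; apply: le_trans (H Jd).
rewrite mulrC -mulrA ler_pM2l//.
apply: (@le_trans _ _ ((1 - d * C) * F v)).
  have : d * C * F v <= eta.
    apply: le_trans d3; rewrite -mulrA ler_pM2l// ler_pM2l ?lerDl// /C; lra.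
  lra.
apply: ler_wpM2r => //; rewrite /C.
have : 0 <= d * (d * (1 - v)^-1) by apply: mulr_ge0; [|apply: mulr_ge0]; exact: ltW.
lra.
Qed.

End content.

(** * The lower bound for MCP densities *)


Section MCP.
Context {R : realType}.
Variables (K N D : R) (h : R -> R).
Hypotheses (N1 : 1 < N) (D0 : 0 < D) (kD : in_model_range (kappa K N) D).
Hypothesis mcp : MCP_density K N D h.
Let k := kappa K N.
Let p := N - 1.
Let p0 : 0 < p. Proof. by rewrite subr_gt0. Qed.

Lemma MCP_ge0 x : 0 <= x -> x <= D -> 0 <= h x.
Proof. by move=> x0 xD; have [+ _ _ _] := mcp; apply; rewrite in_itv/= x0. Qed.

(** Multiplying by the denominator of [sigma] also covers the case where [sigma]
is infinite: [h x0] must then be 0, because [h] is finite. *)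
Lemma MCP_contraction x0 x1 t : 0 <= x0 -> x0 <= D -> 0 <= x1 -> x1 <= D ->
  x0 != x1 -> 0 <= t -> t <= 1 ->
  h x0 * pospow p (s_ k ((1 - t) * `|x1 - x0|)) <=
  h (t * x1 + (1 - t) * x0) * pospow p (s_ k `|x1 - x0|).
Proof.
move=> x00 x0D x10 x1D x01 t0 t1.
have hx0 := MCP_ge0 x00 x0D.
have pn0 : N - 1 != 0 by rewrite gt_eqF// subr_gt0.
have thD : `|x1 - x0| <= D by rewrite ler_norml; apply/andP; split; lra.
have th0 : 0 < `|x1 - x0| by rewrite normr_gt0 subr_eq0 eq_sym.
have x0i : x0 \in `[0, D] by rewrite in_itv/= x00.
have x1i : x1 \in `[0, D] by rewrite in_itv/= x10.
have ti : t \in `[0, 1] by rewrite in_itv/= t0.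
have xtD : 0 <= t * x1 + (1 - t) * x0 <= D by nra.
have hxt : 0 <= h (t * x1 + (1 - t) * x0).
  by case/andP: xtD => ? ?; exact: MCP_ge0.
have [_ _ _ /(_ x0 x1 t x0i x1i ti)] := mcp.
move: xtD thD th0 hxt; set th := `|x1 - x0|; set xt := t * x1 + _.
move=> _ thD th0 hxt.
rewrite /sigma (gt_eqF th0); case: ifPn => [/andP[k0 pith]|npi].
  rewrite (poweRyr pn0) => H.
  have hx00 : h x0 = 0.
    apply/eqP; rewrite eq_le hx0 andbT leNgt; apply/negP => hx0p.
    by move: H; rewrite mulyr gtr0_sg// mul1e leye_eq.
  by rewrite hx00 mul0r; apply: (mulr_ge0 hxt); exact: pospow_ge0.
have sth : 0 < s_ k th.
  apply: sk_gt0 => // k0; move: npi; rewrite negb_and => /orP[|].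
    by rewrite -/k k0.
  by rewrite -ltNge.
have tth : 0 <= s_ k ((1 - t) * th) by apply: (sk_le_ge0 kD); nra.
rewrite poweR_EFin -EFinM lee_fin -/k -/p => H.
have q0 : 0 <= s_ k ((1 - t) * th) / s_ k th by rewrite divr_ge0// ltW.
move: H; rewrite -(pospowE _ q0) => H.
rewrite -(pospow_div _ tth sth) mulrA.
by apply: ler_wpM2r; [exact: pospow_ge0|rewrite mulrC].
Qed.

(** Contract [x] towards the endpoint [D] until it reaches [a]. *)
Lemma MCP_le_left a x : 0 < a -> a < D -> 0 <= x -> x <= a ->
  h x <= h a * pospow p (s_ k (D - x) / s_ k (D - a)).
Proof.
move=> a0 aD x0 xa.
have xD : 0 < D - x by lra.
have sa : 0 < s_ k (D - a) by apply: (sk_lt_gt0 kD); lra.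
have sx : 0 <= s_ k (D - x) by apply: (sk_le_ge0 kD); lra.
pose t := (a - x) / (D - x).
have t0 : 0 <= t by rewrite divr_ge0//; lra.
have t1 : t <= 1 by rewrite ler_pdivrMr// mul1r; lra.
have tE : t * (D - x) = a - x by rewrite divfK// gt_eqF.
have xD' : x != D by rewrite lt_eqF//; lra.
have := @MCP_contraction x D t x0 ltac:(lra) (ltW D0) (lexx D) xD' t0 t1.
rewrite gtr0_norm// (_ : (1 - t) * (D - x) = D - a); last by rewrite mulrBl mul1r tE; ring.
rewrite (_ : t * D + (1 - t) * x = a); last first.
  by rewrite mulrBl mul1r addrCA -mulrBr tE; ring.
rewrite -(pospow_div p sx sa) mulrA => H.
by rewrite -(ler_pM2r (pospow_gt0 p sa)).
Qed.

(** Contract [x] towards the endpoint 0 until it reaches [a]. *)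
Lemma MCP_le_right a x : 0 < a -> a < D -> a <= x -> x <= D ->
  h x <= h a * pospow p (s_ k x / s_ k a).
Proof.
move=> a0 aD ax xD.
have x0 : 0 < x by lra.
have sa : 0 < s_ k a by apply: (sk_lt_gt0 kD); lra.
have sx : 0 <= s_ k x by apply: (sk_le_ge0 kD); lra.
pose t := 1 - a / x.
have t0 : 0 <= t by rewrite subr_ge0 ler_pdivrMr// mul1r.
have t1 : t <= 1 by rewrite gerBl divr_ge0// ltW.
have tE : (1 - t) * x = a by rewrite subKr divfK// gt_eqF.
have := @MCP_contraction x 0 t (ltW x0) xD (lexx 0) (ltW D0) ltac:(by rewrite gt_eqF) t0 t1.
rewrite sub0r normrN gtr0_norm// mulr0 add0r tE.
rewrite -(pospow_div p sx sa) mulrA => H.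
by rewrite -(ler_pM2r (pospow_gt0 p sa)).
Qed.

Variable mu : probability (measurableTypeR R) R.
Hypothesis muE : forall A : set (measurableTypeR R), measurable A ->
      mu A = (\int[lebesgue_measure]_(x in A `&` `[0%R, D]) (h x)%:E)%E.
Let m (A : set R) : R := fine (mu A).
Let F := half_line_profile K N D.

Let mE A : measurable (A : set (measurableTypeR R)) -> mu A = (m A)%:E.
Proof. by move=> mA; rewrite /m fineK// fin_num_measure. Qed.

Let mh : measurable_fun `[0, D] (fun x => (h x)%:E).
Proof. by apply/measurable_EFinP; have [_ + _ _] := mcp. Qed.

Let mass_le (g : R -> R) a b A : 0 <= a -> b <= D -> continuous g ->
  measurable (A : set (measurableTypeR R)) -> A `&` `[0, D] `<=` `[a, b] ->
  (forall x, a <= x -> x <= b -> h x <= g x) -> m A <= itv_int g a b.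
Proof.
move=> a0 bD cg mA Aab hg.
have abD : `[a, b] `<=` `[0, D] by apply: subset_itv; rewrite bnd_simp.
rewrite -lee_fin -mE// muE// EFin_itv_int//.
have mhab : measurable_fun `[a, b] (fun x => (h x)%:E) by exact: measurable_funS mh.
apply: (@le_trans _ _ (\int[lebesgue_measure]_(x in `[a, b]) (h x)%:E)%E).
  apply: ge0_subset_integral => //.
    exact: measurableI.
  by move=> x /abD; rewrite /= in_itv/= lee_fin => /andP[]; exact: MCP_ge0.
apply: ge0_le_integral => //.
- by move=> x /abD; rewrite /= in_itv/= lee_fin => /andP[]; exact: MCP_ge0.
- by apply/measurable_EFinP; apply: measurable_funTS; exact: continuous_measurable_fun.
- by move=> x; rewrite /= in_itv/= lee_fin => /andP[]; exact: hg.
Qed.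

Lemma mass_left a : 0 < a -> a < D -> m `]-oo, a] <= h a * side_mass k p a (D - a).
Proof.
move=> a0 aD.
have cl : continuous (fun y => pospow p (s_ k (D - y) / s_ k (D - a))).
  exact: continuous_left_power.
rewrite -(itv_int_left_side_mass k D p0 (ltW a0)) -(itv_intZ _ _ _ cl).
apply: mass_le => //.
- exact: ltW.
- by move=> x; apply: cvgM; [exact: cvg_cst|exact: cl].
- by move=> x [/=]; rewrite !in_itv/= => -> /andP[-> _].
- by move=> x x0 xa; exact: MCP_le_left.
Qed.

Lemma mass_right a : 0 < a -> a < D -> m `]a, +oo[ <= h a * side_mass k p (D - a) a.
Proof.
move=> a0 aD.
have cr : continuous (fun y => pospow p (s_ k y / s_ k a)).
  rewrite (_ : (fun _ => _) = (fun x => pospow p (s_ k (1 * x + 0) / s_ k a))).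
    exact: continuous_sk_affine.
  by apply/funext => x; rewrite mul1r addr0.
rewrite -(itv_int_right_side_mass k p0 (ltW aD)) -(itv_intZ _ _ _ cr).
apply: mass_le => //.
- exact: ltW.
- by move=> x; apply: cvgM; [exact: cvg_cst|exact: cr].
- by move=> x [/=]; rewrite !in_itv/= andbT => /ltW -> /andP[].
- by move=> x x0 xa; exact: MCP_le_right.
Qed.

Let H x := m `]-oo, x].

Let m_compl x : m `]x, +oo[ = 1 - H x.
Proof.
apply: EFin_inj; rewrite EFinB -!mE// -probability_setC//; congr (mu _).
by rewrite setCitvl.
Qed.

Let m_null A a : 0 <= a -> a <= D -> measurable (A : set (measurableTypeR R)) ->
  A `&` `[0, D] `<=` [set a] -> m A = 0.
Proof.
move=> a0 aD mA Aa; apply: le_anti; apply/andP; split; last exact: fine_ge0.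
rewrite (_ : 0 = itv_int (cst (h a)) a a); last by rewrite itv_int_cst// subrr mulr0.
apply: mass_le => //.
- by move=> x; exact: cvg_cst.
- by move=> x /Aa ->; rewrite /= in_itv/= lexx.
- by move=> x ax xa; rewrite (_ : x = a)//; apply: le_anti; rewrite ax xa.
Qed.

Lemma mu_set1 x : mu [set x] = 0%E.
Proof.
rewrite mE//; congr EFin.
have [/andP[x0 xD]|nx] := boolP (0 <= x <= D).
  by apply: (m_null x0 xD) => // y [].
apply: (@m_null _ 0) => //; first exact: ltW.
by move=> y [/= ->]; rewrite in_itv/= (negbTE nx).
Qed.

(** The isoperimetric inequality for half-lines: by the two mass bounds, [h x]
is a competitor in [profile_min]. *)
Lemma profile_le_density x : 0 < x -> x < D -> F (H x) <= h x.
Proof.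
move=> x0 xD.
have [/andP[H0 H1]|nH] := boolP (0 < H x < 1); last first.
  by rewrite /F half_line_profile_out// MCP_ge0// ltW.
apply: (profile_min N1 D0 kD H0 H1 x0 xD).
  exact: mass_left.
by rewrite -m_compl; exact: mass_right.
Qed.

Let H_left x : x <= 0 -> H x = 0.
Proof.
move=> x0; apply: (@m_null _ 0) => //; first exact: ltW.
move=> y [/=]; rewrite !in_itv/= => yx /andP[y0 _].
by apply: le_anti; rewrite (le_trans yx x0).
Qed.

Let H_right x : D <= x -> H x = 1.
Proof.
move=> Dx; have : m `]x, +oo[ = 0.
  apply: (@m_null _ D) => //; first exact: ltW.
  move=> y [/=]; rewrite !in_itv/= andbT => xy /andP[_ yD].
  by apply: le_anti; rewrite yD (le_trans Dx (ltW xy)).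
by rewrite m_compl => /eqP; rewrite subr_eq0 => /eqP <-.
Qed.

(** If [c] is positive, so is the profile along the interval, which therefore
lies in [0, D]. *)
Lemma profile_density_ge a b c : a < b ->
  (forall x, a < x -> x < b -> c <= F (H x)) -> c * (b - a) <= m `]a, b[.
Proof.
move=> ab cF.
have [c0|c0] := leP c 0.
  apply: (@le_trans _ _ 0); last exact: fine_ge0.
  by rewrite mulr_le0_ge0// subr_ge0 ltW.
have inside x : a < x -> x < b -> 0 < x /\ x < D.
  move=> ax xb; have := lt_le_trans c0 (cF x ax xb) => Fx.
  split; rewrite ltNge; apply/negP => xo; move: Fx; rewrite /F half_line_profile_out ?ltxx//.
    by rewrite H_left// ltxx.
  by rewrite H_right// ltxx andbF.
have abD : `]a, b[ `<=` `[0, D].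
  move=> x; rewrite /= !in_itv/= => /andP[ax xb].
  by have [/ltW -> /ltW] := inside x ax xb.
rewrite -lee_fin -mE// muE// setIidl//.
apply: (@le_trans _ _ (\int[lebesgue_measure]_(x in `]a, b[) (cst c%:E) x)%E).
  rewrite integral_cst//= lebesgue_measure_itv/= lte_fin ab -EFinB -EFinM//.
apply: ge0_le_integral => //.
- by move=> x _; rewrite lee_fin ltW.
- exact: measurable_funS mh.
- move=> x; rewrite /= in_itv/= lee_fin => /andP[ax xb].
  have [x0 xD] := inside x ax xb.
  by apply: le_trans (cF x ax xb) _; exact: profile_le_density.
Qed.

Lemma MCP_minkowski_content_ge (A : set R) (v D' : R) :
  measurable (A : set (measurableTypeR R)) -> A `<=` `[0, D'] -> mu A = v%:E -> v < 1 ->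
  ((F v)%:E <= minkowski_content mu A)%E.
Proof.
move=> mA AD Av v1.
have mAv : m A = v by rewrite /m Av.
exact: (minkowski_content_lower_bound (profile_ge0 N1 D0 kD) (profile0 K N D)
  (profile_sym N1 D0 kD) (profile_ratio_anti N1 D0 kD) mu_set1 profile_density_ge mA AD mAv v1).
Qed.

End MCP.

(** * Probability measures with a continuous density on a segment *)


Section density_probability.
Context {R : realType}.
Variables (g : R -> R) (D : R).

(** The properties of [g] are arguments because the structures of measure and of
probability below depend on them. *)
Definition density_measure (cg : continuous g) (g0 : forall x, 0 <= g x)
    (g1 : itv_int g 0 D = 1) : set (measurableTypeR R) -> \bar R :=
  fun U => (\int[lebesgue_measure]_(x in U `&` `[0%R, D]) (g x)%:E)%E.

Hypotheses (cg : continuous g) (g0 : forall x, 0 <= g x) (g1 : itv_int g 0 D = 1).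

Local Notation P := (density_measure cg g0 g1).

Let mg : measurable_fun setT (fun x => (g x)%:E).
Proof. by apply/measurable_EFinP; exact: continuous_measurable_fun. Qed.

Let P0 : P set0 = 0%E.
Proof. by rewrite /density_measure set0I integral_set0. Qed.

Let P_ge0 U : (0 <= P U)%E.
Proof. by apply: integral_ge0 => x _; rewrite lee_fin. Qed.

Let P_sigma_additive : semi_sigma_additive P.
Proof.
move=> /= F mF tF mUF; rewrite /density_measure; apply: cvg_toP.
  apply: ereal_nondecreasing_is_cvgn => m n mn.
  apply: lee_sum_nneg_natr => // k _ _.
  by apply: integral_ge0 => x _; rewrite lee_fin.
rewrite setI_bigcupl ge0_integral_bigcup//=.
- by move=> i; exact: measurableI.
- exact: measurable_funTS.
- by move=> x _; rewrite lee_fin.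
- apply/trivIsetP => i j _ _ ij; have /trivIsetP Ft := tF.
  by rewrite setIACA (Ft i j I I ij) set0I.
Qed.

HB.instance Definition _ := isMeasure.Build _ _ _ P P0 P_ge0 P_sigma_additive.

Let P_setT : P [set: _] = 1%E.
Proof. by rewrite /density_measure setTI -EFin_itv_int// g1. Qed.

HB.instance Definition _ := @Measure_isProbability.Build _ _ R P P_setT.

Definition density_probability : probability (measurableTypeR R) R := P.

Lemma density_probabilityE A : density_probability A =
  (\int[lebesgue_measure]_(x in A `&` `[0%R, D]) (g x)%:E)%E.
Proof. by []. Qed.

End density_probability.

(** * The model densities attain the lower bound *)


Section model_density.
Context {R : realType}.
Variables (K N D a : R).
Hypotheses (N1 : 1 < N) (kD : in_model_range (kappa K N) D).
Hypotheses (a0 : 0 < a) (aD : a < D).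
Let k := kappa K N.
Let p := N - 1.
Let p0 : 0 < p. Proof. by rewrite subr_gt0. Qed.

Lemma sk_ptolemy_le A B C : 0 <= A -> 0 <= B -> 0 <= C -> A + B + C <= D ->
  s_ k A * s_ k C <= s_ k (A + B) * s_ k (B + C) /\
  s_ k B * s_ k (A + B + C) <= s_ k (A + B) * s_ k (B + C).
Proof.
move=> A0 B0 C0 ABC; have sge x : 0 <= x -> x <= A + B + C -> 0 <= s_ k x.
  by move=> x0 xABC; apply: (sk_le_ge0 kD) => //; exact: le_trans ABC.
have AB0 : 0 <= s_ k A * s_ k C by apply: mulr_ge0; apply: sge; lra.
have BC0 : 0 <= s_ k B * s_ k (A + B + C) by apply: mulr_ge0; apply: sge; lra.
by rewrite [leRHS](sk_ptolemy k A B C) [X in _ /\ _ <= X](sk_ptolemy k A B C) lerDl lerDr.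
Qed.

Let g x := if x <= a then s_ k (D - x) / s_ k (D - a) else s_ k x / s_ k a.

Let sa : 0 < s_ k a. Proof. exact: sk_lt_gt0 kD a0 aD. Qed.

Let sDa : 0 < s_ k (D - a).
Proof. by apply: (sk_lt_gt0 kD); rewrite ?subr_gt0// gtrBl. Qed.

Let g_left x : x <= a -> g x = s_ k (D - x) / s_ k (D - a).
Proof. by rewrite /g => ->. Qed.

Let g_right x : a <= x -> g x = s_ k x / s_ k a.
Proof.
rewrite /g => ax; case: ifPn => // xa.
have -> : x = a by apply: le_anti; rewrite xa ax.
by rewrite !divff// gt_eqF.
Qed.

Let g_ge0 x : 0 <= x -> x <= D -> 0 <= g x.
Proof.
move=> x0 xD; have [xa|/ltW ax] := leP x a.
  by rewrite g_left// divr_ge0//; [apply: (sk_le_ge0 kD); lra|exact: ltW].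
by rewrite g_right// divr_ge0//; [exact: (sk_le_ge0 kD)|exact: ltW].
Qed.

(** Composes two contractions through the base point, the common factor being
[y].  That factor vanishes when the contraction is towards the base point
itself. *)
Let combine (x y z u v w : R) : 0 <= x -> 0 <= y -> 0 <= z -> 0 <= u -> 0 <= v -> 0 <= w ->
  (y = 0 -> x = 0) -> y * u <= v * z -> x * v <= w * y -> x * u <= w * z.
Proof.
move=> x0; rewrite le_eqVlt => /predU1P[<- z0 u0 v0 w0 /(_ erefl) -> _ _|y0 z0 u0 v0 w0 _ h1 h2].
  by rewrite mul0r mulr_ge0.
rewrite -(ler_pM2r y0); nra.
Qed.

Let ler_div2 (x y z w c : R) : 0 < c -> x * y <= z * w -> x * (y / c) <= z / c * w.
Proof.
by move=> c0 H; rewrite mulrA [z / c * w]mulrAC ler_pM2r// invr_gt0.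
Qed.

(** On either side of the base point the inequality is a case of
[sk_ptolemy_le]; across it, contract first to the base point and then from
there. *)
Let g_contraction_right x0 x x1 : 0 <= x0 -> x0 <= x -> x <= x1 -> x1 <= D ->
  s_ k (x1 - x) * g x0 <= g x * s_ k (x1 - x0).
Proof.
have right_case y0 y y1 : a <= y0 -> y0 <= y -> y <= y1 -> y1 <= D ->
    s_ k (y1 - y) * g y0 <= g y * s_ k (y1 - y0).
  move=> ay0 y0y yy1 y1D; rewrite (g_right ay0) (g_right (le_trans ay0 y0y)).
  have y00 : 0 <= y0 by rewrite (le_trans (ltW a0)).
  have [+ _] := @sk_ptolemy_le y0 (y - y0) (y1 - y) y00 ltac:(lra) ltac:(lra) ltac:(lra).
  rewrite (_ : y0 + (y - y0) = y); last by ring.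
  rewrite (_ : y - y0 + (y1 - y) = y1 - y0); last by ring.
  by rewrite [s_ k y0 * _]mulrC; exact: ler_div2.
have left_case y0 y y1 : 0 <= y0 -> y0 <= y -> y <= a -> y <= y1 -> y1 <= D ->
    s_ k (y1 - y) * g y0 <= g y * s_ k (y1 - y0).
  move=> y00 y0y ya yy1 y1D; rewrite (g_left ya) (g_left (le_trans y0y ya)).
  have [_] := @sk_ptolemy_le (y - y0) (y1 - y) (D - y1) ltac:(lra) ltac:(lra) ltac:(lra) ltac:(lra).
  rewrite (_ : y - y0 + (y1 - y) + (D - y1) = D - y0); last by ring.
  rewrite (_ : y - y0 + (y1 - y) = y1 - y0); last by ring.
  rewrite (_ : y1 - y + (D - y1) = D - y); last by ring.
  by rewrite [s_ k (y1 - y0) * _]mulrC; exact: ler_div2.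
move=> x00 x0x xx1 x1D.
have [ax0|/ltW x0a] := leP a x0; first exact: right_case.
have [xa|/ltW ax] := leP x a; first exact: left_case.
have [x10 aD' a0'] : [/\ 0 <= x1, a <= D & 0 <= a] by move: a0 aD; split; lra.
apply: (@combine _ (s_ k (x1 - a)) _ _ (g a)).
- by apply: (sk_le_ge0 kD); lra.
- by apply: (sk_le_ge0 kD); lra.
- by apply: (sk_le_ge0 kD); lra.
- by apply: g_ge0 => //; lra.
- by apply: g_ge0 => //; lra.
- by apply: g_ge0 => //; lra.
- have [e _|x1a] := eqVneq x1 a.
    have xx : x1 - x = 0 by apply/eqP; rewrite subr_eq0 e eq_le ax -e xx1.
    by rewrite xx sk0.
  have x1a0 : 0 < x1 - a by rewrite subr_gt0 lt_neqAle eq_sym x1a (le_trans ax).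
  have x1aD : x1 - a < D by move: a0 => a0''; lra.
  by move=> e; have := sk_lt_gt0 kD x1a0 x1aD; rewrite -/k e ltxx.
- by apply: left_case => //; lra.
- by apply: right_case.
Qed.

Let g_contraction_left x0 x x1 : 0 <= x1 -> x1 <= x -> x <= x0 -> x0 <= D ->
  s_ k (x - x1) * g x0 <= g x * s_ k (x0 - x1).
Proof.
have right_case y0 y y1 : 0 <= y1 -> a <= y -> y1 <= y -> y <= y0 -> y0 <= D ->
    s_ k (y - y1) * g y0 <= g y * s_ k (y0 - y1).
  move=> y10 ay y1y yy0 y0D; rewrite (g_right ay) (g_right (le_trans ay yy0)).
  have [_] := @sk_ptolemy_le y1 (y - y1) (y0 - y) y10 ltac:(lra) ltac:(lra) ltac:(lra).
  rewrite (_ : y1 + (y - y1) + (y0 - y) = y0); last by ring.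
  rewrite (_ : y1 + (y - y1) = y); last by ring.
  rewrite (_ : y - y1 + (y0 - y) = y0 - y1); last by ring.
  exact: ler_div2.
have left_case y0 y y1 : 0 <= y1 -> y1 <= y -> y <= y0 -> y0 <= a -> y0 <= D ->
    s_ k (y - y1) * g y0 <= g y * s_ k (y0 - y1).
  move=> y10 y1y yy0 y0a y0D; rewrite (g_left y0a) (g_left (le_trans yy0 y0a)).
  have [+ _] := @sk_ptolemy_le (D - y0) (y0 - y) (y - y1) ltac:(lra) ltac:(lra) ltac:(lra) ltac:(lra).
  rewrite (_ : D - y0 + (y0 - y) = D - y); last by ring.
  rewrite (_ : y0 - y + (y - y1) = y0 - y1); last by ring.
  by rewrite [s_ k (D - y0) * _]mulrC; exact: ler_div2.
move=> x10 x1x xx0 x0D.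
have [x0a|/ltW ax0] := leP x0 a; first exact: left_case.
have [ax|/ltW xa] := leP a x; first exact: right_case.
have [x00 aD' a0'] : [/\ 0 <= x0, a <= D & 0 <= a] by move: a0 aD; split; lra.
apply: (@combine _ (s_ k (a - x1)) _ _ (g a)).
- by apply: (sk_le_ge0 kD); lra.
- by apply: (sk_le_ge0 kD); lra.
- by apply: (sk_le_ge0 kD); lra.
- by apply: g_ge0 => //; lra.
- by apply: g_ge0 => //; lra.
- by apply: g_ge0 => //; lra.
- have [e _|x1a] := eqVneq a x1.
    have xx : x - x1 = 0 by apply/eqP; rewrite subr_eq0 eq_le x1x -e xa.
    by rewrite xx sk0.
  have x1a0 : 0 < a - x1 by rewrite subr_gt0 lt_neqAle eq_sym x1a (le_trans x1x).
  have x1aD : a - x1 < D by move: aD => aD''; lra.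
  by move=> e; have := sk_lt_gt0 kD x1a0 x1aD; rewrite -/k e ltxx.
- by apply: right_case => //; lra.
- by apply: left_case.
Qed.

Let g_contraction x0 x1 t : 0 <= x0 -> x0 <= D -> 0 <= x1 -> x1 <= D -> 0 <= t -> t <= 1 ->
  s_ k ((1 - t) * `|x1 - x0|) * g x0 <= g (t * x1 + (1 - t) * x0) * s_ k `|x1 - x0|.
Proof.
move=> x00 x0D x10 x1D t0 t1.
have [x01|/ltW x10'] := leP x0 x1.
  rewrite ger0_norm ?subr_ge0//.
  rewrite (_ : (1 - t) * (x1 - x0) = x1 - (t * x1 + (1 - t) * x0)); last by ring.
  by apply: g_contraction_right => //; nra.
rewrite distrC ger0_norm ?subr_ge0//.
rewrite (_ : (1 - t) * (x0 - x1) = t * x1 + (1 - t) * x0 - x1); last by ring.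
by apply: g_contraction_left => //; nra.
Qed.

Let f := f_ K N D a.
Let h := h_ K N D a.

Lemma f_gt0 : 0 < f.
Proof.
rewrite /f (f_side_massE N1 kD a0 aD) invr_gt0.
exact: (addr_gt0 (side_mass_left_gt0 p0 kD a0 aD) (side_mass_right_gt0 p0 kD a0 aD)).
Qed.

Let hE x : 0 <= x -> x <= D -> h x = f * pospow p (g x).
Proof.
move=> x0 xD; rewrite (pospowE p (g_ge0 x0 xD)) /h /h_ /g -/f -/k.
by case: (x <= a).
Qed.

Let model_MCP_ineq x0 x1 t : x0 \in `[0, D] -> x1 \in `[0, D] -> t \in `[0, 1] ->
  (poweR (sigma K N (1 - t)%R `|x1 - x0|%R) (N - 1)%R * (h x0)%:E
         <= (h (t * x1 + (1 - t) * x0)%R)%:E)%E.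
Proof.
move=> x0i x1i ti.
have /andP[x00 x0D] : 0 <= x0 <= D by move: x0i; rewrite in_itv.
have /andP[x10 x1D] : 0 <= x1 <= D by move: x1i; rewrite in_itv.
have /andP[t0 t1] : 0 <= t <= 1 by move: ti; rewrite in_itv.
have xt0 : 0 <= t * x1 + (1 - t) * x0 by nra.
have xtD : t * x1 + (1 - t) * x0 <= D by nra.
have hx0 : 0 <= h x0.
  by rewrite hE//; apply: mulr_ge0; [exact/ltW/f_gt0|exact: pospow_ge0].
have hc := g_contraction x00 x0D x10 x1D t0 t1.
have th0 : 0 <= `|x1 - x0| by [].
have thD : `|x1 - x0| <= D by rewrite ler_norml; apply/andP; split; lra.
rewrite /sigma; case: ifPn => [/eqP th|thn].
  have e10 : x1 = x0 by apply/eqP; rewrite -subr_eq0 -normr_eq0 th.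
  have -> : t * x1 + (1 - t) * x0 = x0 by rewrite e10; ring.
  rewrite poweR_EFin -EFinM lee_fin ler_piMl//.
  have t1' : 0 <= 1 - t by rewrite subr_ge0.
  have one : pospow p 1 = 1 by rewrite pospowE// powR1.
  rewrite -(pospowE _ t1') -[leRHS]one.
  by apply: (le_pospow (ltW p0)); rewrite gerBl.
have {thn}th0 : 0 < `|x1 - x0| by rewrite lt_neqAle eq_sym thn.
case: ifPn => [/andP[k0 pith]|npi].
  (* An infinite [sigma] means that [x0] and [x1] are the ends of a segment of
     maximal length, and the density vanishes there. *)
  have DE : D = pi / Num.sqrt k by apply: le_anti; rewrite (kD k0) (le_trans pith thD).
  have thDE : `|x1 - x0| = D by apply: le_anti; rewrite thD DE.
  have sD0 : s_ k D = 0 by rewrite DE sk_pi.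
  have -> : h x0 = 0.
    rewrite hE//; have [x0a|ax0] := leP x0 a.
      have x0z : x0 = 0.
        move: thDE; have [x01|x10'] := leP x0 x1.
          by rewrite ger0_norm ?subr_ge0//; lra.
        by rewrite ltr0_norm ?subr_lt0//; move: aD; lra.
      by rewrite (g_left x0a) x0z subr0 sD0 mul0r pospowE// powR0 ?mulr0// gt_eqF.
    have x0DE : x0 = D.
      move: thDE; have [x01|x10'] := leP x0 x1.
        by rewrite ger0_norm ?subr_ge0//; move: a0; lra.
      by rewrite ltr0_norm ?subr_lt0//; lra.
    by rewrite (g_right (ltW ax0)) x0DE sD0 mul0r pospowE// powR0 ?mulr0// gt_eqF.
  rewrite mule0 lee_fin hE//; apply: mulr_ge0; [exact/ltW/f_gt0|exact: pospow_ge0].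
have sth : 0 < s_ k `|x1 - x0|.
  apply: sk_gt0 => // k0; move: npi; rewrite negb_and => /orP[|].
    by rewrite -/k k0.
  by rewrite -ltNge.
have tth : 0 <= s_ k ((1 - t) * `|x1 - x0|) by apply: (sk_le_ge0 kD); nra.
rewrite poweR_EFin -EFinM lee_fin -/k.
have r0 : 0 <= s_ k ((1 - t) * `|x1 - x0|) / s_ k `|x1 - x0| by rewrite divr_ge0// ltW.
have gx0 := g_ge0 x00 x0D.
rewrite (hE x00 x0D) (hE xt0 xtD) mulrCA; apply: (ler_wpM2l (ltW f_gt0)).
rewrite (pospowE p gx0) -(powRM _ r0 gx0) -(pospowE _ (mulr_ge0 r0 gx0)).
apply: (le_pospow (ltW p0)).
by rewrite mulrAC ler_pdivrMr.
Qed.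

(** Each factor is 1 on the side of [a] that belongs to the other one.  The
product is continuous on the whole line and extends [h_]. *)
Definition model_density_ext x : R :=
  f * (pospow p (s_ k (D - Num.min x a) / s_ k (D - a)) *
       pospow p (s_ k (Num.max x a) / s_ k a)).
Let hc := model_density_ext.

Lemma continuous_model_density_ext : continuous hc.
Proof.
have cmin : continuous (fun x : R => Num.min x a).
  by move=> x; apply: continuous_min; [exact: cvg_id|exact: cvg_cst].
have cmax : continuous (fun x : R => Num.max x a).
  by move=> x; apply: continuous_max; [exact: cvg_id|exact: cvg_cst].
have cl := @continuous_left_power R K N D N1 a.
have cr : continuous (fun y => pospow p (s_ k y / s_ k a)).
  rewrite (_ : (fun _ => _) = (fun x => pospow p (s_ k (1 * x + 0) / s_ k a))).
    exact: continuous_sk_affine.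
  by apply/funext => x; rewrite mul1r addr0.
move=> x; apply: cvgM; first exact: cvg_cst.
apply: cvgM.
  exact: (continuous_comp (cmin x) (cl _)).
exact: (continuous_comp (cmax x) (cr _)).
Qed.

Lemma model_density_ext_ge0 x : 0 <= hc x.
Proof.
apply: mulr_ge0; first exact/ltW/f_gt0.
by apply: mulr_ge0; exact: pospow_ge0.
Qed.

Let pospow1 : pospow p 1 = 1.
Proof. by rewrite pospowE// powR1. Qed.

Let hc_left x : x <= a -> hc x = f * pospow p (s_ k (D - x) / s_ k (D - a)).
Proof.
move=> xa; rewrite /hc /model_density_ext (min_idPl xa) (max_idPr xa).
by rewrite [s_ k a / _]divff ?gt_eqF// pospow1 mulr1.
Qed.

Let hc_right x : a <= x -> hc x = f * pospow p (s_ k x / s_ k a).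
Proof.
move=> ax; rewrite /hc /model_density_ext (min_idPr ax) (max_idPl ax).
by rewrite [s_ k (D - a) / _]divff ?gt_eqF// pospow1 mul1r.
Qed.

Lemma model_density_extE x : 0 <= x -> x <= D -> hc x = h x.
Proof.
move=> x0 xD; rewrite (hE x0 xD); have [xa|/ltW ax] := leP x a.
  by rewrite (hc_left xa) (g_left xa).
by rewrite (hc_right ax) (g_right ax).
Qed.

Lemma model_MCP_density : MCP_density K N D h.
Proof.
have hcE : {in `[0, D], hc =1 h}.
  by move=> x; rewrite in_itv => /andP[]; exact: model_density_extE.
split.
- by move=> x xi; rewrite -(hcE x xi); exact: model_density_ext_ge0.
- apply: (@eq_measurable_fun _ _ _ _ `[0, D] hc).
    by move=> x; rewrite inE; exact: hcE.
  by apply: measurable_funTS; apply: continuous_measurable_fun; exact: continuous_model_density_ext.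
- apply: (@subspace_eq_continuous _ `[0, D] _ hc).
    by move=> x; rewrite inE; exact: hcE.
  exact/continuous_subspaceT/continuous_model_density_ext.
- exact: model_MCP_ineq.
Qed.

Lemma itv_int_model_left : itv_int hc 0 a = f * side_mass k p a (D - a).
Proof.
have cl := @continuous_left_power R K N D N1 a.
rewrite -(itv_int_left_side_mass k D p0 (ltW a0)) -(itv_intZ _ _ _ cl).
by apply: eq_itv_int => x _ xa; exact: hc_left.
Qed.

Lemma itv_int_model_right : itv_int hc a D = f * side_mass k p (D - a) a.
Proof.
have cr : continuous (fun y => pospow p (s_ k y / s_ k a)).
  rewrite (_ : (fun _ => _) = (fun x => pospow p (s_ k (1 * x + 0) / s_ k a))).
    exact: continuous_sk_affine.
  by apply/funext => x; rewrite mul1r addr0.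
rewrite -(itv_int_right_side_mass k p0 (ltW aD)) -(itv_intZ _ _ _ cr).
by apply: eq_itv_int => x ax _; exact: hc_right.
Qed.

Lemma itv_int_model : itv_int hc 0 D = 1.
Proof.
rewrite (itv_int_cat continuous_model_density_ext (ltW a0) (ltW aD)).
rewrite itv_int_model_left itv_int_model_right -mulrDr.
rewrite [X in X * _](f_side_massE N1 kD a0 aD); apply: mulVf; rewrite gt_eqF//.
exact: (addr_gt0 (side_mass_left_gt0 p0 kD a0 aD) (side_mass_right_gt0 p0 kD a0 aD)).
Qed.

Lemma model_density_ext_at : hc a = f.
Proof. by rewrite (hc_left (lexx a)) divff ?gt_eqF// pospow1 mulr1. Qed.

Definition model_probability : probability (measurableTypeR R) R :=
  density_probability continuous_model_density_ext model_density_ext_ge0 itv_int_model.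

Lemma model_probability_F_tilde : F_tilde K N D model_probability.
Proof.
exists h; first exact: model_MCP_density.
move=> A mA; rewrite density_probabilityE; apply: eq_integral => x.
by rewrite inE => -[_]; rewrite /= in_itv/= => /andP[x0 xD]; rewrite model_density_extE.
Qed.

Let m (A : set R) : R := fine (model_probability A).

Let mass_le b (A : set R) : measurable (A : set (measurableTypeR R)) ->
  A `&` `[0, D] `<=` `[0, b] -> m A <= itv_int hc 0 b.
Proof.
move=> mA Ab.
rewrite -lee_fin /m fineK ?fin_num_measure// density_probabilityE.
rewrite (EFin_itv_int _ _ continuous_model_density_ext).
apply: ge0_subset_integral => //.
- exact: measurableI.
- apply/measurable_EFinP; apply: measurable_funTS; apply: continuous_measurable_fun.
  exact: continuous_model_density_ext.
- by move=> x _; rewrite lee_fin model_density_ext_ge0.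
Qed.

Lemma model_probability_left : model_probability `[0, a]%classic = (f * side_mass k p a (D - a))%:E.
Proof.
rewrite density_probabilityE -itv_int_model_left.
rewrite (EFin_itv_int _ _ continuous_model_density_ext) setIidl//.
by apply: subset_itv; rewrite bnd_simp// ltW.
Qed.

(** The thickening adds only a short segment to the right of [a], on which the
density is close to its value at [a]. *)
Lemma model_minkowski_content_le :
  (minkowski_content model_probability `[0%R, a]%classic <= f%:E)%E.
Proof.
apply: minkowski_content_le => // eta r eta0 r0.
have ca : hc x @[x --> a] --> hc a by exact: continuous_model_density_ext.
have /cvgrPdist_lt/(_ eta eta0)[d/= d0 Hd] := ca.
pose e := Num.min (r / 2) (d / 2).
have e0 : 0 < e by rewrite lt_min !divr_gt0.
have er : e <= r / 2 by rewrite ge_min lexx.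
have ed : e <= d / 2 by rewrite ge_min lexx orbT.
exists e; split => //; first by lra.
rewrite ler_pdivrMr//.
have mT : m (thickening `[0, a]%classic e) <= itv_int hc 0 (a + e).
  apply: mass_le; first exact: (open_measurable (@thickening_open R _ e)).
  move=> x [[y]]; rewrite /= !in_itv/= => /andP[_ ya] + /andP[-> _].
  by rewrite ltr_norml => /andP[_ h2]; lra.
have mA : m `[0, a]%classic = itv_int hc 0 a.
  by rewrite /m model_probability_left itv_int_model_left.
have ae : a <= a + e by rewrite lerDl ltW.
move: mT; rewrite (itv_int_cat continuous_model_density_ext (ltW a0) ae) -mA -lerBlDl => mT.
apply: le_trans mT _.
apply: (@le_trans _ _ (itv_int (cst (f + eta)) a (a + e))).
  apply: (le_itv_int continuous_model_density_ext); first by move=> x; exact: cvg_cst.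
  move=> x ax xae.
  have : `|a - x| < d by rewrite distrC ger0_norm ?subr_ge0//; lra.
  move=> /Hd; rewrite model_density_ext_at ltr_norml => /andP[+ _]; rewrite /= /cst -/hc.
  by move: (hc x) => z; lra.
by rewrite itv_int_cst// [a + e]addrC addrK.
Qed.

End model_density.

(** * The representation of the profile *)

Section representation.
Context {R : realType}.
Variables (K N D v : R).
Hypotheses (N1 : 1 < N) (D0 : 0 < D) (kD : in_model_range (kappa K N) D).
Hypotheses (v0 : 0 < v) (v1 : v < 1).

Lemma isoperimetric_profile_le D' : 0 < D' -> D' <= D ->
  (isoperimetric_profile K N D v <= (f_ K N D' (a_ K N D' v))%:E)%E.
Proof.
move=> D'0 D'D.
have kD' : in_model_range (kappa K N) D' by move=> k0; exact: le_trans (kD k0).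
have [a0 aD fL _] := a_spec N1 D'0 kD' v0 v1.
apply: le_trans (model_minkowski_content_le N1 kD' a0 aD).
apply: ereal_inf_lbound.
exists (model_probability N1 kD' a0 aD), `[0, a_ K N D' v]%classic; split.
- exists D'; first by rewrite /= in_itv/= D'0.
  exact: model_probability_F_tilde.
- exact: measurable_itv.
- apply: subset_itv; rewrite bnd_simp//.
  exact: le_trans (ltW aD) D'D.
- by rewrite model_probability_left fL.
- by [].
Qed.

Lemma minkowski_content_ge_profile (mu : probability (measurableTypeR R) R)
    (A : set (measurableTypeR R)) D' :
  0 < D' -> D' <= D -> F_tilde K N D' mu -> measurable A -> A `<=` `[0, D] ->
  mu A = v%:E -> ((f_ K N D' (a_ K N D' v))%:E <= minkowski_content mu A)%E.
Proof.
move=> D'0 D'D [h mcp muE] mA AD Av.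
have kD' : in_model_range (kappa K N) D' by move=> k0; exact: le_trans (kD k0).
have v01 : 0 < v < 1 by rewrite v0.
rewrite -(half_line_profileE K N D' v01).
exact: (MCP_minkowski_content_ge N1 D'0 kD' mcp muE mA AD Av v1).
Qed.

End representation.

Theorem corollary3p10 (R : realType) (K N D v : R)
  (hN : 1 < N) (hD : 0 < D)
  (hKD : 0 < K -> D <= pi * Num.sqrt ((N - 1) / K))
  (hv : 0 < v < 1) :
  isoperimetric_profile K N D v =
    if K <= 0 then (f_ K N D (a_ K N D v))%:E
    else ereal_inf [set (f_ K N D' (a_ K N D' v))%:E | D' in `]0, D]].
Proof.
have kD := in_model_range_diameter hN hKD.
have /andP[v0 v1] := hv.
apply: le_anti; apply/andP; split.
- case: ifPn => [K0|K0]; first exact: isoperimetric_profile_le.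
  apply: le_ereal_inf_tmp => _ [D' + <-]; rewrite /= in_itv => /andP[D'0 D'D].
  exact: isoperimetric_profile_le.
- apply: le_ereal_inf_tmp => _ [mu [A [[D' + muF] mA AD Av ->]]].
  rewrite /= in_itv => /andP[D'0 D'D].
  have lower := minkowski_content_ge_profile hN kD v0 v1 D'0 D'D muF mA AD Av.
  apply: le_trans lower; case: ifPn => [K0|K0].
    rewrite lee_fin -(half_line_profileE K N D hv) -(half_line_profileE K N D' hv).
    exact: profile_diam_anti.
  by apply: ereal_inf_lbound; exists D'; [rewrite /= in_itv; exact/andP|].
Qed.
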